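(* Suppose simple random walk on $\overline{\mathbb{G}}$ is transient, all sites (but not all edges) of $\overline{\mathbb{G}}$ are in $\mathbb{G}_0$, and $$S_\star:=\sum_{x\in\partial\mathbb{G}_0}\ \sup_{y\in\mathcal{C}(x)}\mathbb{P}_y\big(\text{simple random walk on }\overline{\mathbb{G}}\text{ ever hits }0\big)<\infty .$$ Then almost every sample path in any open by touch (OBT) extended simple random walk $Y_t$ on $\mathbb{G}_t\uparrow\mathbb{G}_\infty$ is transient. The same applies for any partially open by touch (POBT) extended simple random walk, provided $\overline{\mathbb{G}}$ is of uniformly bounded degrees. In particular, in case $\overline{\mathbb{G}}=\mathbb{Z}^d$, $d\ge3$ (writing $\mathbb{D}_t$ for $\mathbb{G}_t$), let $N(k)$ denote the number of vertices in $\partial\mathbb{D}_0$ that are on the boundary of the box of side length $k$ centered at $0$. Then with probability one the sample path of a POBT extended simple random walk $Y_t$ on $\mathbb{D}_t\uparrow\mathbb{D}_\infty$ is transient, provided $$\sum_{k=1}^\infty N(k)\,k^{2-d}<\infty .$$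
   Context: Setting: $\overline{\mathbb{G}}$ is a locally finite connected graph with distinguished vertex $0$; $\{\mathbb{G}_t\}_{t\ge0}$ is a non-decreasing sequence of connected subgraphs of $\overline{\mathbb{G}}$, started at a given $\mathbb{G}_0$, with $\mathbb{G}_t\uparrow\mathbb{G}_\infty\subseteq\overline{\mathbb{G}}$. The process $\{Y_t\}$, $Y_t\in\mathbb{G}_t$, starts at $Y_0=0$, is adapted to a filtration $\{\mathcal{F}_t\}$, and $\{\mathbb{G}_t\}$ is $\mathcal{F}_\cdot$-previsible (the graph growth may depend on the walk). $d^{\overline{\mathbb{G}}}$ is the graph distance and $\mathbb{B}^{\overline{\mathbb{G}}}(z,r)$ the closed ball of radius $r$ and center $z$. Standing assumption: $\mathbb{B}^{\overline{\mathbb{G}}}(0,1)\subset\mathbb{G}_0$ (all edges of $\overline{\mathbb{G}}$ at $0$ are in $\mathbb{G}_0$). The boundary is $\partial\mathbb{G}_t:=\{z\in\mathbb{G}_t:\deg_{\mathbb{G}_t}(z)<\deg_{\overline{\mathbb{G}}}(z)\}$. Interaction models. In all of them $\mathbb{G}_{t+1}=\mathbb{G}_t$ unless $Y_t\in\partial\mathbb{G}_t$. - Open by touch (OBT): whenever $Y_t\in\partial\mathbb{G}_t$, all edges of $\mathbb{B}^{\overline{\mathbb{G}}}(Y_t,1)$, i.e. all edges of $\overline{\mathbb{G}}$ adjacent to $Y_t$, are added to $\mathbb{G}_{t+1}$. - Partially open by touch (POBT): whenever $Y_t\in\partial\mathbb{G}_t$, with (conditional on the past) probability at least some constant $\epsilon>0$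 (uniform in time and in the past), one or more of the not yet open edges of $\overline{\mathbb{G}}$ adjacent to $Y_t$ is added to $\mathbb{G}_{t+1}$. - Remotely open by touch (ROBT): the collection of edges added to $\mathbb{G}_t$ when $Y_t\in\partial\mathbb{G}_t$ is of uniformly bounded cardinality. Extended simple random walk: an ROBT interaction model forms an extended simple random walk if $Y_t$ follows the steps of simple random walk on $\overline{\mathbb{G}}$ (i.e. $Y_{t+1}$ is uniform among the neighbors of $Y_t$ in $\overline{\mathbb{G}}$), except that whenever $Y_t\in\partial\mathbb{G}_t$ it is allowed to use any $\mathcal{F}_t$-measurable mechanism for choosing $Y_{t+1}\in\mathbb{G}_t\cap\mathcal{C}(Y_t)$, where $\mathcal{C}(x):=\mathbb{B}^{\overline{\mathbb{G}}}(x,r(x))$ for some fixed constant $c<1$ and fixed function $r$ with $1\le r(x)\le c\,d^{\overline{\mathbb{G}}}(x,0)$ for all vertices $x$ at which boundary visits may occur (here, $x\in\partial\mathbb{G}_0$). An OBT (POBT) extended simple random walk is an OBT (POBT) interaction model forming an extended simple random walk. The sample path is transient if $Y_t=0$ for only finitely many $t$. $\mathbb{P}_y$ is the law of simple random walk on $\overline{\mathbb{G}}$ started at $y$. In the case $\overline{\mathbb{G}}=\mathbb{Z}^d$, it is still assumed that all sites, but not all edges, of $\mathbb{Z}^d$ are in $\mathbb{D}_0$; the box of side length $k$ centered at $0$ is $[-k/2,k/2]^d$. *)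

(* Defs.v *)
From HB Require Import structures.
From mathcomp Require Import all_boot all_order all_algebra.
From mathcomp Require Import finmap.
From mathcomp Require Import all_classical all_reals all_analysis.
Set Implicit Arguments.
Unset Strict Implicit.
Unset Printing Implicit Defensive.
Import Order.TTheory GRing.Theory Num.Theory.
Local Open Scope classical_set_scope.
Local Open Scope ring_scope.

Section Graphs.
Variables (V : choiceType) (e : rel V).

Definition gconnected (A : set V) (f : rel V) : Prop :=
  forall x y, A x -> A y -> exists p : seq V, path f x p /\ last x p = y.

Definition locally_finite : Prop := forall x, finite_set [set y | e x y].

(* Junk value 0 at a vertex with infinitely many neighbours. *)
Definition degree (f : rel V) (x : V) : nat := #|` fset_set [set y | f x y]|.

Definition bounded_degrees : Prop :=
  exists D : nat, forall x, (degree e x <= D)%N.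

Definition walk_of_length (x y : V) (n : nat) : bool :=
  `[< exists p : seq V, [/\ path e x p, last x p = y & size p = n] >].

(* Junk value 0 when y cannot be reached from x. *)
Definition gdist (x y : V) : nat :=
  if pselect (exists n, walk_of_length x y n) is left h then ex_minn h else 0%N.

Definition gball (R : realType) (x : V) (r : R) : set V :=
  [set y | (gdist x y)%:R <= r].

Record subgraph := Subgraph {
  vert : set V;
  edge : rel V;
  edge_sym : symmetric edge;
  edge_sub : subrel edge e;
  edge_vert : forall x y, edge x y -> vert x /\ vert y }.

Definition sub_le (G H : subgraph) : Prop :=
  vert G `<=` vert H /\ subrel (edge G) (edge H).

Definition boundary (G : subgraph) : set V :=
  [set z | vert G z /\ (degree (edge G) z < degree e z)%N].

Definition spanning (G : subgraph) : Prop := vert G = setT.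

Definition missing_edge (G : subgraph) : Prop :=
  exists x y, e x y /\ ~~ edge G x y.

Definition star_open (G : subgraph) (x : V) : Prop :=
  forall z, e x z -> edge G x z.

Definition srw_step (R : realType) (x z : V) : R :=
  if e x z then (degree e x)%:R^-1 else 0.

Definition transient_path (o : V) (y : nat -> V) : Prop :=
  finite_set [set t | y t = o].

(* Under Q y the process X is a simple random walk started at y; its law is
   given through the probabilities of all the cylinders. *)
Definition srw_family (R : realType) (dW : measure_display)
    (W : measurableType dW) (Q : V -> probability W R) (X : nat -> W -> V) :=
  (forall n x, measurable [set w | X n w = x]) /\
  forall y : V, Q y [set w | X 0%N w = y] = 1%:E /\
    forall (n : nat) (s : nat -> V),
      Q y [set w | forall i, (i <= n.+1)%N -> X i w = s i] =
      (Q y [set w | forall i, (i <= n)%N -> X i w = s i] *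
       (srw_step R (s n) (s n.+1))%:E)%E.

End Graphs.

Section Probability.
Variables (R : realType) (dT : measure_display) (T : measurableType dT).
Variable P : probability T R.

Definition filtration (F : nat -> set (set T)) : Prop :=
  [/\ forall t, sigma_algebra setT (F t),
      forall t, F t `<=` measurable &
      forall s t, (s <= t)%N -> F s `<=` F t].

(* f is a version of the conditional probability of B given the
   sub-sigma-algebra H. *)
Definition is_cond_prob (H : set (set T)) (B : set T) (f : T -> R) : Prop :=
  [/\ forall C : set R, measurable C -> H (f @^-1` C),
      P.-integrable setT (EFin \o f) &
      forall A, H A -> (\int[P]_(w in A) (f w)%:E = P (A `&` B))%E].

End Probability.

Section Models.
Variables (V : choiceType) (e : rel V) (o : V) (G0 : subgraph e).
Variables (R : realType) (dT : measure_display) (T : measurableType dT).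
Variables (P : probability T R) (F : nat -> set (set T)).
Variables (G : nat -> T -> subgraph e) (Y : nat -> T -> V).

Record growing_walk : Prop := GrowingWalk {
  gw_filtration : filtration F;
  gw_init : forall w, G 0%N w = G0;
  gw_mono : forall t w, sub_le (G t w) (G t.+1 w);
  gw_connected : forall t w, gconnected (vert (G t w)) (edge (G t w));
  gw_previsible_vert : forall t x, F t [set w | vert (G t.+1 w) x];
  gw_previsible_edge : forall t x y, F t [set w | edge (G t.+1 w) x y];
  gw_adapted : forall t x, F t [set w | Y t w = x];
  gw_start : forall w, Y 0%N w = o;
  gw_in : forall t w, vert (G t w) (Y t w);
  gw_star : star_open G0 o }.

Definition at_boundary (t : nat) (w : T) : Prop :=
  boundary (G t w) (Y t w).

Definition grows_by_touch : Prop :=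
  forall t w, ~ at_boundary t w -> G t.+1 w = G t w.

Definition OBT : Prop :=
  grows_by_touch /\
  forall t w, at_boundary t w -> star_open (G t.+1 w) (Y t w).

(* G t.+1 is already F t-measurable, so the past of the growth decision taken
   at time t is not F t but the history of the walk and of the graphs up to
   time t. *)
Definition past (t : nat) : set (set T) :=
  <<s [set A | exists s, (s <= t)%N /\
        [\/ exists x, A = [set w | Y s w = x],
            exists x, A = [set w | vert (G s w) x] |
            exists x y, A = [set w | edge (G s w) x y]] ] >>.

Definition edge_opened (t : nat) : set T :=
  [set w | exists z, [/\ e (Y t w) z, ~~ edge (G t w) (Y t w) z &
                         edge (G t.+1 w) (Y t w) z]].

Definition POBT : Prop :=
  grows_by_touch /\
  exists eps : R, 0 < eps /\ forall t, exists f : T -> R,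
    is_cond_prob P (past t) (edge_opened t) f /\
    {ae P, forall w, at_boundary t w -> eps <= f w}.

(* The law used to choose Y t.+1 at a boundary visit is constrained only by its
   support. *)
Record extended_srw (c : R) (r : V -> R) : Prop := ExtendedSrw {
  es_c : c < 1;
  es_radius : forall x, boundary G0 x ->
    1 <= r x /\ r x <= c * (gdist e x o)%:R;
  es_step : forall t z, exists f : T -> R,
    is_cond_prob P (F t) [set w | Y t.+1 w = z] f /\
    {ae P, forall w, ~ at_boundary t w -> f w = srw_step e R (Y t w) z};
  es_jump : forall t w, at_boundary t w ->
    vert (G t w) (Y t.+1 w) /\ gball e (Y t w) (r (Y t w)) (Y t.+1 w) }.

End Models.

Section Lattice.
Variable d : nat.

Definition zadj : rel 'rV[int]_d :=
  fun x y => \sum_(i < d) `|x 0 i - y 0 i| == 1.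

Definition box_boundary (k : nat) : set 'rV[int]_d :=
  [set x | (forall i, `|(x 0 i)%:Q| <= k%:R / 2) /\
           exists i, `|(x 0 i)%:Q| = k%:R / 2].

Definition boundary_count (G : subgraph zadj) (k : nat) : nat :=
  #|` fset_set (boundary G `&` box_boundary k)|.

End Lattice.

(* Main.v *)
Require Import Defs.
From HB Require Import structures.
From mathcomp Require Import all_boot all_order all_algebra.
From mathcomp Require Import finmap.
From mathcomp Require Import all_classical all_reals all_analysis.
From mathcomp Require Import ring lra zify.
Import Order.TTheory GRing.Theory Num.Theory numFieldNormedType.Exports.
Local Open Scope classical_set_scope.
Local Open Scope ring_scope.

(** Let [h >= 0] be superharmonic for the walk on the full graph, with a drop of
    at least [gamma > 0] at [o], and let [s x] bound [h] on the ball from which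
    the walk may continue after a boundary visit to [x].  Then the mean of
    [h (Y t)] decreases by [gamma * P (Y t = o)] in one step, up to an increase
    of at most [s x] for a boundary visit to [x].  So [gamma] times the expected
    number of visits to [o] is at most [h o] plus the sum over [x] of [s x] times
    the expected number of boundary visits to [x].  The latter number is at most
    [1] for OBT and at most (max degree) / eps for POBT, and Borel-Cantelli
    concludes.  For a general graph [h] is the probability of hitting [o].  On
    [Z^d] the asymptotics of the Green function are avoided: for [A] large,
    [(|x|^2 + A)^(- (d - 2) / 2)] is superharmonic, strictly so at the origin,
    and of order [|x|^(2 - d)]. *)

(** * Locally finite graphs *)

Definition nbrs {V : choiceType} (e : rel V) (x : V) : {fset V} :=
  fset_set [set y | e x y].

Section GraphFacts.
Context {V : choiceType} {e : rel V}.
Hypothesis lf : locally_finite e.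

Lemma mem_nbrs (x y : V) : (y \in nbrs e x) = e x y.
Proof. by rewrite in_fset_set //; apply/idP/idP; rewrite inE. Qed.

(** The open neighbours form a finite subset of all neighbours, so equal degrees force equality.
    This replaces cardinalities by edges, which suits monotonicity and measurability. *)
Lemma boundaryE {G : subgraph e} {x : V} :
  vert G x -> boundary G x <-> ~ star_open G x.
Proof.
move=> vx; have fe : finite_set [set y | edge G x y].
  by apply: sub_finite_set (lf x) => y; exact: edge_sub.
split => [[_ lt] so|nso].
  move: lt; rewrite /degree (_ : [set y | edge G x y] = [set y | e x y]) ?ltnn //.
  by apply/seteqP; split => y /=; [exact: edge_sub|exact: so].
split=> //; apply: fproper_ltn_card; rewrite fproperE; apply/andP; split.
  by apply/fsubsetP => y; rewrite !in_fset_set // !inE; exact: edge_sub.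
apply: contra_notN nso => /fsubsetP sub z exz.
by have := sub z; rewrite !in_fset_set // !inE => /(_ exz).
Qed.

Lemma gdist_walk (x y : V) : (exists p, path e x p /\ last x p = y) ->
  exists p, [/\ path e x p, last x p = y & size p = gdist e x y].
Proof.
case=> p [pp lp]; rewrite /gdist; case: pselect => [h|[]]; last first.
  by exists (size p); apply/asboolP; exists p.
by case: ex_minnP => n /asboolP.
Qed.

Lemma gdist_le_size (x : V) (p : seq V) :
  path e x p -> (gdist e x (last x p) <= size p)%N.
Proof.
move=> pp; rewrite /gdist; case: pselect => [h|//].
by case: ex_minnP => n _; apply; apply/asboolP; exists p.
Qed.

Lemma gball_center (R : realType) (x : V) (r : R) : 0 <= r -> gball e x r x.
Proof.
move=> r0; rewrite /gball /=; have := gdist_le_size x [::] isT.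
by rewrite /= leqn0 => /eqP ->.
Qed.

(** By induction on [n], the endpoints of walks of length [n] from a base vertex are countable in
    number. Countability allows summing over the position of the walk. *)
Lemma countable_vertices : gconnected setT e -> countable [set: V].
Proof.
move=> conn; have [[x0 _]|/forallNP no] := pselect (exists o : V, True); last first.
  suff -> : [set: V] = set0 by exact: countable0.
  by apply/seteqP; split => x // _; exact: no I.
pose L n := [set y | exists p, [/\ path e x0 p, last x0 p = y & size p = n]].
suff Lfin n : countable (L n).
  have -> : [set: V] = \bigcup_n L n.
    apply/seteqP; split => y // _; have [p [pp lp]] := conn x0 y I I.
    by exists (size p) => //; exists p.
  by apply: bigcup_countable => // n _; exact: Lfin.
elim: n => [|n ih].
  apply: (@sub_countable _ _ _ [set x0]); last exact: countable1.
  by apply: subset_card_le => y [p [_ + /size0nil p0]]; rewrite p0 /= => <-.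
apply: (@sub_countable _ _ _ (\bigcup_(x in L n) [set y | e x y])).
  apply: subset_card_le => y [p]; elim/last_ind: p => [[_ _ //]|p z _ [pp]].
  rewrite last_rcons size_rcons => + [sz]; move: pp.
  rewrite rcons_path => /andP[pp lz] <-; exists (last x0 p) => //.
  by exists p.
by apply: bigcup_countable => // x _; exact: finite_set_countable.
Qed.

Lemma degree_gt0 (x : V) :
  gconnected setT e -> (exists y z, e y z) -> (0 < degree e x)%N.
Proof.
move=> conn [y [z eyz]]; suff [u eu] : exists u, e x u.
  by rewrite /degree cardfs_gt0; apply/fset0Pn; exists u; rewrite mem_nbrs.
have [[|u p] /= [pp lp]] := conn x y I I; first by exists z; rewrite lp.
by exists u; case/andP: pp.
Qed.

Lemma srw_step_ge0 (R : realType) (x z : V) : 0 <= srw_step e R x z.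
Proof. by rewrite /srw_step; case: ifP => // _; rewrite invr_ge0. Qed.

End GraphFacts.

(** * Conditional probabilities *)

Section SigmaAlgebra.
Context {dT : measure_display} {T : measurableType dT} {H : set (set T)}.
Hypothesis sH : sigma_algebra setT H.

(** A sigma-algebra given as a set of sets consists of the measurable sets of the type it generates,
    whose closure properties are reused. *)
Lemma sigma_algebra_setI (A B : set T) : H A -> H B -> H (A `&` B).
Proof.
by rewrite -(measurable_g_measurableTypeE sH); exact: measurableI.
Qed.

Lemma sigma_algebra_setC (A : set T) : H A -> H (~` A).
Proof.
by rewrite -(measurable_g_measurableTypeE sH); exact: measurableC.
Qed.

Lemma sigma_algebra_fin_bigcup (I : Type) (D : set I) (A : I -> set T) :
  finite_set D -> (forall i, D i -> H (A i)) -> H (\bigcup_(i in D) A i).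
Proof.
by rewrite -(measurable_g_measurableTypeE sH); exact: fin_bigcup_measurable.
Qed.

Context {R : realType} {P : probability T R}.
Hypothesis subH : H `<=` measurable.

Lemma ae_setI (D E B : set T) : measurable D -> measurable E -> measurable B ->
  {ae P, forall w, D w -> E w} -> P (D `&` B) = P (D `&` E `&` B).
Proof.
move=> mD mE mB ae; rewrite (measureDI P (measurableI _ _ mD mB) mE).
rewrite [X in (X + _)%E](_ : _ = 0%E) ?add0e; first by rewrite setIAC.
apply: measure_negligible; first by apply: measurableD => //; exact: measurableI.
by apply: negligibleS ae => w [[Dw Bw] nE] /(_ Dw).
Qed.

(** The almost sure condition on [f] is made to hold everywhere: intersecting [D] with a preimage
    under [f] stays in [H] and discards only a null set. *)
Lemma cond_prob_restrict {B D C} {f : T -> R} : measurable B ->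
  is_cond_prob P H B f -> H D -> measurable C ->
  {ae P, forall w, D w -> C (f w)} ->
  [/\ measurable (D `&` f @^-1` C), P (D `&` f @^-1` C) = P D &
      P (D `&` B) = (\int[P]_(w in D `&` f @^-1` C) (f w)%:E)%E].
Proof.
move=> mB [mf _ intf] HD mC ae; have HC := mf _ mC.
have HDC : H (D `&` f @^-1` C) by exact: sigma_algebra_setI.
have [mD mfC] := (subH _ HD, subH _ HC); split; first exact: subH.
  by have := ae_setI _ (f @^-1` C) setT mD mfC measurableT ae; rewrite !setIT.
by rewrite intf //; exact: ae_setI.
Qed.

Lemma cond_prob_cst (B D : set T) (f : T -> R) (a : R) : measurable B ->
  is_cond_prob P H B f -> H D -> {ae P, forall w, D w -> f w = a} ->
  P (D `&` B) = (a%:E * P D)%E.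
Proof.
move=> mB cp HD ae.
have [mE PE ->] := cond_prob_restrict (C := [set a]) mB cp HD (measurable_set1 a) ae.
rewrite -PE -(integral_cst P mE); apply: eq_integral => w.
by rewrite inE => -[_ /= ->].
Qed.

Lemma cond_prob_ge (B D : set T) (f : T -> R) (a : R) : measurable B ->
  0 <= a -> is_cond_prob P H B f -> H D ->
  {ae P, forall w, D w -> a <= f w} -> (a%:E * P D <= P (D `&` B))%E.
Proof.
move=> mB a0 cp HD ae.
have mC : measurable [set x : R | a <= x] by rewrite -set_itvcy; exact: measurable_itv.
have [mE PE ->] := cond_prob_restrict mB cp HD mC ae.
rewrite -PE -(integral_cst P mE); apply: ge0_le_integral => //=.
- have [_ /measurable_int mf _] := cp.
  exact: measurable_funS mf.
- by move=> w [_ /= ?]; rewrite lee_fin.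
Qed.

End SigmaAlgebra.

(** * Sums over the fibres of a random variable *)

Section EsumFacts.
Local Open Scope ereal_scope.
Context {R : realType}.

Lemma esum_exchange {I J : choiceType} (A : set I) (B : set J) (a : I -> J -> \bar R) :
  (forall i j, 0 <= a i j) ->
  \esum_(i in A) \esum_(j in B) a i j = \esum_(j in B) \esum_(i in A) a i j.
Proof.
move=> a0; rewrite !esum_esum //.
rewrite (reindex_esum (A `*` B) (B `*` A) (fun p => (p.2, p.1))) //.
split=> [[i j] [] //|[i j] [i' j'] _ _ [-> ->] //|[j i] [Bj Ai]].
by exists (i, j).
Qed.

(** One inequality is proved for every factor; applied to [k^-1] it gives the other. *)
Lemma esumZl {I : choiceType} (A : set I) (k : R) (a : I -> \bar R) :
  (0 <= k)%R -> (forall i, 0 <= a i) ->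
  \esum_(i in A) (k%:E * a i) = k%:E * \esum_(i in A) a i.
Proof.
move=> k0 a0; have ge (l : R) (b : I -> \bar R) : (0 <= l)%R -> (forall i, 0 <= b i) ->
    \esum_(i in A) (l%:E * b i) <= l%:E * \esum_(i in A) b i.
  move=> l0 b0; apply: ge_ereal_sup => _ [X [finX XA] <-].
  rewrite fsbig_finite //= -ge0_sume_distrr //; apply: lee_wpmul2l; rewrite ?lee_fin //.
  by apply: ereal_sup_ubound; exists X => //; rewrite fsbig_finite.
apply/eqP; rewrite eq_le ge //=; have [->|kn0] := eqVneq k 0%R.
  by rewrite mul0e esum_ge0 // => i _; rewrite mul0e.
have {kn0}k0 : (0 < k)%R by rewrite lt_neqAle eq_sym kn0.
rewrite muleC -lee_pdivlMr // muleC.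
apply: le_trans (ge k^-1%R (fun i => k%:E * a i) _ _); last 2 first.
- by rewrite invr_ge0 ltW.
- by move=> i; rewrite mule_ge0 // lee_fin ltW.
by apply: le_esum => i _; rewrite muleA -EFinM mulVf ?mul1e // gt_eqF.
Qed.

Context {dT : measure_display} {T : measurableType dT} {P : probability T R}.
Context {V : choiceType} {Y : T -> V}.
Hypothesis mY : forall x, measurable [set w | Y w = x].

Lemma esum_fibers_le (A : set T) : measurable A ->
  \esum_(x in [set: V]) P (A `&` [set w | Y w = x]) <= P A.
Proof.
move=> mA; apply: ge_ereal_sup => _ [X [finX _] <-].
have mF x : measurable (A `&` [set w | Y w = x]) by exact: measurableI.
rewrite -measure_fin_bigcup //; last first.
  by move=> x y _ _ [w [[_ /= <-] [_ /= <-]]].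
apply: le_measure; rewrite ?inE //; first by apply: fin_bigcup_measurable.
by move=> w [x _ []].
Qed.

(** An injection of the values into the naturals makes the fibres a sequence, empty off its range,
    to which countable subadditivity applies. *)
Lemma le_esum_fibers (A : set T) : countable [set: V] -> measurable A ->
  P A <= \esum_(x in [set: V]) P (A `&` [set w | Y w = x]).
Proof.
move=> /countable_injP[f finj] mA.
pose S n := A `&` \bigcup_(x in [set x | f x = n]) [set w | Y w = x].
have Sf x : S (f x) = A `&` [set w | Y w = x].
  apply/seteqP; split=> w [Aw]; last by move=> /= <-; split=> //; exists (Y w).
  by case=> y /= /finj; rewrite !inE => <-.
have S0 n : ~ range f n -> S n = set0.
  by move=> nfn; rewrite -subset0 => w [_ [x /= fx _]]; apply: nfn; exists x.
have mS n : measurable (S n).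
  have [[x _ <-]|/S0 ->] := pselect (range f n); last exact: measurable0.
  by rewrite Sf; exact: measurableI.
have AS : A `<=` \bigcup_n S n.
  by move=> w Aw; exists (f (Y w)) => //; rewrite Sf.
apply: le_trans (measure_sigma_subadditive P mS mA AS) _.
rewrite nneseries_esumT // (esumID (range f)) // !setTI.
rewrite [X in _ + X]esum1 => [|n /S0 ->]; last exact: measure0.
rewrite adde0 esum_image; last by move=> x y _ _; apply: finj; rewrite inE.
by under eq_esum => x _ do rewrite Sf.
Qed.

End EsumFacts.

(** * The expected number of visits to the origin *)

Section Walk.
Context {V : choiceType} {e : rel V} {o : V} {G0 : subgraph e} {R : realType}.
Context {dT : measure_display} {T : measurableType dT} {P : probability T R}.
Context {F : nat -> set (set T)} {G : nat -> T -> subgraph e} {Y : nat -> T -> V}.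
Hypothesis lf : locally_finite e.
Hypothesis cV : countable [set: V].
Hypothesis sp : spanning G0.
Hypothesis gw : growing_walk o G0 F G Y.

Lemma vert_all (t : nat) (w : T) (x : V) : vert (G t w) x.
Proof.
elim: t => [|t]; last exact: (gw_mono gw t w).1.
by rewrite (gw_init gw) (sp : vert G0 = setT).
Qed.

Lemma edge_mono (s t : nat) (w : T) (x y : V) :
  (s <= t)%N -> edge (G s w) x y -> edge (G t w) x y.
Proof.
move=> /subnKC <-; elim: (t - s)%N => [|n ih]; first by rewrite addn0.
by move=> /ih; rewrite addnS; exact: (gw_mono gw _ w).2.
Qed.

Lemma star_open_mono (s t : nat) (w : T) (x : V) :
  (s <= t)%N -> star_open (G s w) x -> star_open (G t w) x.
Proof. by move=> st so z /so; exact: edge_mono. Qed.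

(** An open star stays open, so the boundary only shrinks, and sums over [boundary G0] account for
    all boundary visits. *)
Lemma boundary_init (t : nat) (w : T) (x : V) : boundary (G t w) x -> boundary G0 x.
Proof.
move=> /(boundaryE lf (vert_all _ _ _)) nso.
apply/(boundaryE lf); first by rewrite (sp : vert G0 = setT).
by rewrite -(gw_init gw w) => /(star_open_mono 0 t w x (leq0n t)).
Qed.

(** The star of [o] is open from the start. So every visit to [o] is followed by a step of simple
    random walk, and the drop [gamma] is collected. *)
Lemma origin_not_boundary (t : nat) (w : T) : ~ boundary (G t w) o.
Proof.
move=> /boundary_init /(boundaryE lf); rewrite (sp : vert G0 = setT).
by move=> /(_ I); apply; exact: gw_star gw.
Qed.

(** Visits to [x] are split by the rule for the next step: on [touch] only its range is known, on
    [no_touch] its law. *)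
Definition touch (t : nat) (x : V) : set T :=
  [set w | Y t w = x /\ boundary (G t w) x].

Definition no_touch (t : nat) (x : V) : set T :=
  [set w | Y t w = x /\ ~ boundary (G t w) x].

(** Local finiteness makes the union over missing edges finite. The sigma-algebra is arbitrary
    because the result serves for both [F t] and [past]. *)
Lemma sigma_touch {H : set (set T)} {t : nat} : sigma_algebra setT H ->
  (forall x, H [set w | Y t w = x]) ->
  (forall x y, H [set w | edge (G t w) x y]) -> forall x, H (touch t x).
Proof.
move=> sH HY HG x.
suff -> : touch t x = [set w | Y t w = x] `&`
    \bigcup_(z in [set z | e x z]) ~` [set w | edge (G t w) x z].
  apply: sigma_algebra_setI => //; apply: sigma_algebra_fin_bigcup => // z _.
  exact: sigma_algebra_setC.
apply/seteqP; split=> w [Yx].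
  move=> /(boundaryE lf (vert_all _ _ _)); rewrite /star_open => /existsNP[z].
  by rewrite not_implyE => -[xz nG]; split => //; exists z.
move=> [z xz nG]; split=> //; apply/(boundaryE lf (vert_all _ _ _)).
by move=> /(_ z xz).
Qed.

Lemma filtrationS {t : nat} : F t `<=` F t.+1.
Proof. by case: (gw_filtration gw) => _ _; apply. Qed.

Lemma sigmaF (t : nat) : sigma_algebra setT (F t).
Proof. by case: (gw_filtration gw). Qed.

Lemma measurableF {t : nat} {A : set T} : F t A -> measurable A.
Proof. by case: (gw_filtration gw) => _ + _; apply. Qed.

(** At positive times previsibility gives this one step early; the initial graph is
    deterministic. *)
Lemma edge_adapted (t : nat) (x y : V) : F t [set w | edge (G t w) x y].
Proof.
case: t => [|t]; last by apply: filtrationS; exact: gw_previsible_edge gw t x y.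
have [Gxy|nG] := boolP (edge G0 x y).
  rewrite (_ : [set _ | _] = ~` set0).
    by apply: sigma_algebra_setC (sigmaF 0) _ _; case: (sigmaF 0).
  by rewrite setC0; apply/seteqP; split => w _ //=; rewrite (gw_init gw).
rewrite (_ : [set _ | _] = set0); first by case: (sigmaF 0).
by apply/seteqP; split => w //=; rewrite (gw_init gw) (negbTE nG).
Qed.

Lemma touch_adapted (t : nat) (x : V) : F t (touch t x).
Proof.
by apply: sigma_touch (sigmaF t) _ _ x; [exact: gw_adapted gw t|exact: edge_adapted].
Qed.

Lemma no_touch_setD (t : nat) (x : V) :
  no_touch t x = [set w | Y t w = x] `&` ~` touch t x.
Proof.
apply/seteqP; split=> w [Yx nb]; split=> //; first by case.
by move=> bw; apply: nb; split.
Qed.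

Lemma no_touch_adapted (t : nat) (x : V) : F t (no_touch t x).
Proof.
rewrite no_touch_setD; apply: sigma_algebra_setI (sigmaF t) _ _ _ _.
  exact: gw_adapted gw t x.
by apply: sigma_algebra_setC (sigmaF t) _ _; exact: touch_adapted.
Qed.

Lemma measurable_at (t : nat) (x : V) : measurable [set w | Y t w = x].
Proof. exact: measurableF (gw_adapted gw t x). Qed.

Lemma measurable_touch (t : nat) (x : V) : measurable (touch t x).
Proof. exact: measurableF (touch_adapted t x). Qed.

Lemma measurable_no_touch (t : nat) (x : V) : measurable (no_touch t x).
Proof. exact: measurableF (no_touch_adapted t x). Qed.

Lemma measure_touch_split (t : nat) (x : V) (B : set T) : measurable B ->
  P (B `&` [set w | Y t w = x]) = (P (no_touch t x `&` B) + P (touch t x `&` B))%E.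
Proof.
move=> mB; rewrite -measureU.
- congr (P _); apply/seteqP; split=> w /=; last by case=> -[[]].
  by move=> [Bw Yx]; have [|] := pselect (boundary (G t w) x); [right|left].
- by apply: measurableI => //; exact: measurable_no_touch.
- by apply: measurableI => //; exact: measurable_touch.
- by apply/seteqP; split=> w // -[[[_ nb] _] [[_]]].
Qed.

Context {c : R} {r : V -> R}.
Hypothesis es : extended_srw o G0 P F G Y c r.

Lemma no_touch_step (t : nat) (x z : V) :
  P (no_touch t x `&` [set w | Y t.+1 w = z]) =
  ((srw_step e R x z)%:E * P (no_touch t x))%E.
Proof.
have [f [cp fE]] := es_step es t z.
apply: (cond_prob_cst (sigmaF t) (fun A => measurableF (A := A)) _ _ _ _ _ cp).
- exact: measurable_at.
- exact: no_touch_adapted.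
by apply: filterS fE => w + [Yx nb]; rewrite /at_boundary Yx; apply.
Qed.

(** * One-step drift of a superharmonic function along the walk *)

Context {h : V -> R} {gamma : R} {s : V -> \bar R}.
Hypothesis h_ge0 : forall x, 0 <= h x.
Hypothesis gamma_gt0 : 0 < gamma.
Hypothesis h_super : forall x,
  \sum_(z <- nbrs e x) srw_step e R x z * h z + (if x == o then gamma else 0) <= h x.
Hypothesis h_jump : forall x y,
  boundary G0 x -> gball e x (r x) y -> ((h y)%:E <= s x)%E.

Local Open Scope ereal_scope.

(** Since [r x >= 1], the ball contains its centre, whence [s x >= h x]. *)
Lemma jump_bound_ge0 (x : V) : boundary G0 x -> 0 <= s x.
Proof.
move=> bx; have [r1 _] := es_radius es bx.
apply: le_trans (h_jump _ _ bx (gball_center _ _ _ _)); first by rewrite lee_fin.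
exact: le_trans r1.
Qed.

(** Superharmonicity at [x], multiplied by the probability of [no_touch t x]. The term with [gamma]
    survives only at [x = o], where a visit is never a boundary visit. *)
Lemma no_touch_mean (t : nat) (x : V) :
  \esum_(z in [set: V]) (h z)%:E * P (no_touch t x `&` [set w | Y t.+1 w = z]) +
    gamma%:E * P ([set w | Y t w = o] `&` [set w | Y t w = x]) <=
  (h x)%:E * P (no_touch t x).
Proof.
have -> : P ([set w | Y t w = o] `&` [set w | Y t w = x]) =
    (if x == o then 1 else 0) * P (no_touch t x).
  have [->|xo] := eqVneq x o.
    rewrite mul1e setIid; congr (P _); apply/seteqP; split => w /=; last by case.
    by move=> Yo; split => //; exact: origin_not_boundary.
  rewrite mul0e (_ : _ `&` _ = set0) ?measure0 //.
  by apply/seteqP; split=> w // -[/= ->] ox; rewrite ox eqxx in xo.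
have -> : \esum_(z in [set: V]) (h z)%:E * P (no_touch t x `&` [set w | Y t.+1 w = z]) =
    (\sum_(z <- nbrs e x) srw_step e R x z * h z)%:E * P (no_touch t x).
  transitivity (\esum_(z in [set z | e x z])
      (h z)%:E * P (no_touch t x `&` [set w | Y t.+1 w = z])).
    rewrite [RHS]esum_mkcond; apply: eq_esum => z _.
    case: ifPn => //; rewrite notin_setE /= => /negP exz.
    by rewrite no_touch_step /srw_step (negbTE exz) mul0e mule0.
  rewrite esum_fset // ?fsbig_finite //=; last first.
    by move=> z _; rewrite mule_ge0 // lee_fin.
  rewrite -sumEFin ge0_sume_distrl; last first.
    by move=> z _; rewrite lee_fin mulr_ge0 // srw_step_ge0.
  by apply: eq_bigr => z _; rewrite no_touch_step muleA EFinM (muleC (h z)%:E).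
rewrite muleA -ge0_muleDl.
- apply: lee_wpmul2r => //; apply: le_trans (_ : _ <= (_ + _)%:E) _; last first.
    by rewrite lee_fin; exact: h_super.
  by rewrite EFinD leeD2l //; case: ifP => _; rewrite ?mule1 ?mule0.
- by rewrite lee_fin sumr_ge0 // => z _; rewrite mulr_ge0 // srw_step_ge0.
- by case: ifP => _; rewrite ?mule1 ?mule0 // lee_fin ltW.
Qed.

(** Whatever the law of the jump, it lands where [h] is at most [s x]. *)
Lemma touch_mean (t : nat) (x : V) :
  \esum_(z in [set: V]) (h z)%:E * P (touch t x `&` [set w | Y t.+1 w = z]) <=
  if x \in boundary G0 then s x * P (touch t x) else 0.
Proof.
case: ifPn => [|]; rewrite ?notin_setE ?inE => bx; last first.
  rewrite esum1 // => z _; rewrite (_ : _ `&` _ = set0) ?measure0 ?mule0 //.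
  by apply/seteqP; split=> w // -[[_ /boundary_init]].
have s0 := jump_bound_ge0 x bx.
(* An infinite [s x] makes the bound trivial unless the event is null; then both sides vanish, as
   [+oo * 0 = 0]. *)
have [soo|sfin] := eqVneq (s x) +oo.
  have := measure_ge0 P (touch t x); rewrite le_eqVlt => /orP[/eqP P0|P0]; last first.
    by rewrite soo gt0_mulye ?leey.
  rewrite -P0 mule0 esum1 // => z _.
  rewrite (_ : P _ = 0) ?mule0 //; apply/eqP; rewrite eq_le measure_ge0 andbT P0.
  apply: le_measure; rewrite ?inE //.
  - by apply: measurableI; [exact: measurable_touch|exact: measurable_at].
  - exact: measurable_touch.
have {sfin}fs : s x \is a fin_num by rewrite ge0_fin_numE // ltey.
rewrite -(fineK fs).
apply: le_trans (_ : \esum_(z in [set: V]) (fine (s x))%:E *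
    P (touch t x `&` [set w | Y t.+1 w = z]) <= _).
  apply: le_esum => z _.
  have [[w [[Yx bw] Yz]]|nw] :=
    pselect ((touch t x `&` [set w | Y t.+1 w = z]) !=set0).
    apply: lee_wpmul2r => //; rewrite fineK //; apply: h_jump => //.
    have atb : at_boundary G Y t w by rewrite /at_boundary Yx.
    by have [_] := es_jump es atb; rewrite Yx (Yz : Y t.+1 w = z).
  rewrite (_ : _ `&` _ = set0) ?measure0 ?mule0 //.
  by apply/seteqP; split=> w // ?; apply: nw; exists w.
rewrite esumZl //; last by rewrite fine_ge0.
apply: lee_wpmul2l; first by rewrite lee_fin fine_ge0.
by apply: esum_fibers_le; [exact: measurable_at|exact: measurable_touch].
Qed.

(** The two preceding bounds are summed over the position [x] at time [t]. No term is subtracted,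
    since the sums may be infinite. *)
Lemma mean_step (t : nat) :
  \esum_(z in [set: V]) (h z)%:E * P [set w | Y t.+1 w = z] +
    gamma%:E * P [set w | Y t w = o] <=
  \esum_(x in [set: V]) (h x)%:E * P [set w | Y t w = x] +
    \esum_(x in boundary G0) s x * P (touch t x).
Proof.
pose fr x z := (h z)%:E * P (no_touch t x `&` [set w | Y t.+1 w = z]).
pose to x z := (h z)%:E * P (touch t x `&` [set w | Y t.+1 w = z]).
have fr0 x z : 0 <= fr x z by rewrite mule_ge0 // lee_fin.
have to0 x z : 0 <= to x z by rewrite mule_ge0 // lee_fin.
pose go x := gamma%:E * P ([set w | Y t w = o] `&` [set w | Y t w = x]).
have go0 x : 0 <= go x by rewrite mule_ge0 // lee_fin ltW.
apply: le_trans (_ : _ <= \esum_(x in [set: V]) (\esum_(z in [set: V]) fr x z + go x) +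
    \esum_(x in [set: V]) \esum_(z in [set: V]) to x z) _.
  rewrite esumD => [|x _|x _] //; last exact: esum_ge0.
  rewrite addeAC; apply: leeD; last first.
    rewrite esumZl //; last exact: ltW.
    apply: lee_wpmul2l; first by rewrite lee_fin ltW.
    by apply: le_esum_fibers => // [x|]; exact: measurable_at.
  rewrite esum_exchange // (esum_exchange _ _ to) //.
  rewrite -esumD => [|x _|x _] //; try exact: esum_ge0.
  apply: le_esum => z _; rewrite -esumD //.
  apply: le_trans (_ : _ <= (h z)%:E * \esum_(x in [set: V])
     P ([set w | Y t.+1 w = z] `&` [set w | Y t w = x])) _.
    rewrite lee_wpmul2l ?lee_fin //.
    by apply: le_esum_fibers => // [x|]; exact: measurable_at.
  rewrite -esumZl //; apply: le_esum => x _.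
  rewrite measure_touch_split; last exact: measurable_at.
  by rewrite ge0_muleDr.
apply: leeD.
  apply: le_esum => x _; apply: le_trans (no_touch_mean t x) _.
  rewrite lee_wpmul2l ?lee_fin //; apply: le_measure; rewrite ?inE.
  - exact: measurable_no_touch.
  - exact: measurable_at.
  - by move=> w [].
rewrite [leRHS]esum_mkcond; apply: le_esum => x _; exact: touch_mean.
Qed.

(** The one-step bounds telescope; at time 0 the walk sits at [o]. *)
Lemma visits_bound (n : nat) :
  \esum_(z in [set: V]) (h z)%:E * P [set w | Y n w = z] +
  \sum_(t < n) gamma%:E * P [set w | Y t w = o] <=
  (h o)%:E + \esum_(x in boundary G0) s x * \sum_(t < n) P (touch t x).
Proof.
have esum_go0 m : 0 <= \esum_(z in [set: V]) (h z)%:E * P [set w | Y m w = z].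
  by apply: esum_ge0 => z _; rewrite mule_ge0 // lee_fin.
elim: n => [|n ih].
  rewrite big_ord0 adde0; apply: le_trans (_ : _ <= (h o)%:E) _; last first.
    by rewrite leeDl // esum_ge0 // => x _; rewrite big_ord0 mule0.
  rewrite (esumID [set o]) // => [|z _]; last by rewrite mule_ge0 // lee_fin.
  rewrite setTI [X in _ + X]esum1 ?adde0 => [|z [_ /= zo]].
    rewrite esum_set1; last by rewrite mule_ge0 // lee_fin.
    rewrite -[leRHS]mule1 lee_wpmul2l ?lee_fin //; apply: probability_le1.
    exact: measurable_at.
  rewrite (_ : [set _ | _] = set0) ?measure0 ?mule0 //.
  apply/seteqP; split=> w //=; rewrite (gw_start gw) => oz.
  by apply: zo.
rewrite big_ord_recr /= addeCA addeC.
have {}ih := leeD ih (lexx (\esum_(x in boundary G0) s x * P (touch n x))).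
apply: le_trans (_ : _ <= \esum_(x in [set: V]) (h x)%:E * P [set w | Y n w = x] +
    \esum_(x in boundary G0) s x * P (touch n x) +
    \sum_(t < n) gamma%:E * P [set w | Y t w = o]) _.
  by apply: leeD => //; exact: mean_step.
rewrite addeAC; apply: le_trans ih _.
rewrite -addeA leeD2l // -esumD => [|x bx|x bx].
- apply: le_esum => x bx; rewrite big_ord_recr /= ge0_muleDr //.
  exact: sume_ge0.
- by rewrite mule_ge0 ?sume_ge0 // jump_bound_ge0.
- by rewrite mule_ge0 // jump_bound_ge0.
Qed.

Lemma transience_of_touch_bound (K : R) :
  \esum_(x in boundary G0) s x < +oo ->
  (forall x n, boundary G0 x -> \sum_(t < n) P (touch t x) <= K%:E) ->
  {ae P, forall w, transient_path o (Y ^~ w)}.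
Proof.
move=> sfin touchK; pose A t := [set w | Y t w = o].
have mA t : measurable (A t) by exact: measurable_at.
have K0 : forall x, boundary G0 x -> (0 <= K)%R.
  by move=> x bx; rewrite -lee_fin; apply: le_trans (touchK x 0%N bx); rewrite big_ord0.
(* The absolute value covers an empty [boundary G0], for which nothing forces [K] to be
   nonnegative. *)
pose C := `|K|%:E * \esum_(x in boundary G0) s x.
have Cfin : C \is a fin_num.
  rewrite fin_numM // ge0_fin_numE // esum_ge0 // => x; exact: jump_bound_ge0.
have bound n : gamma%:E * \sum_(t < n) P (A t) <= (h o)%:E + C.
  have := visits_bound n; rewrite -ge0_sume_distrr // => vb.
  have {vb}: gamma%:E * \sum_(t < n) P (A t) <=
      (h o)%:E + \esum_(x in boundary G0) s x * \sum_(t < n) P (touch t x).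
    apply: le_trans vb; rewrite leeDr // esum_ge0 // => z _.
    by rewrite mule_ge0 // lee_fin.
  move/le_trans; apply; rewrite leeD2l // /C.
  (* [s] is known to be nonnegative only on [boundary G0]; extending it by 0 makes [esumZl]
     applicable. *)
  pose s' x := if x \in boundary G0 then s x else 0.
  have s'0 x : 0 <= s' x.
    by rewrite /s'; case: ifPn => //; rewrite inE; exact: jump_bound_ge0.
  have -> : \esum_(x in boundary G0) s x = \esum_(x in boundary G0) s' x.
    by apply: eq_esum => x bx; rewrite /s' mem_set.
  rewrite -esumZl //; apply: le_esum => x bx.
  rewrite /s' mem_set // muleC lee_wpmul2r ?jump_bound_ge0 //.
  by rewrite ger0_norm ?touchK // (K0 x bx).
have sumfin : \sum_(t <oo) P (A t) < +oo.
  apply: le_lt_trans (_ : _ <= ((fine ((h o)%:E + C)) / gamma)%:E) (ltry _).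
  apply: lime_le; first by apply: is_cvg_nneseries => n _ _.
  apply: nearW => n; rewrite EFinM lee_pdivlMr // fineK.
    by rewrite muleC big_mkord; exact: bound.
  by rewrite fin_numD Cfin.
exists (lim_sup_set A); split; last 2 first.
- exact: lim_sup_set_cvg0.
(* Without a visit at or after time [n], all visiting times would lie below [n] and be finitely
   many. *)
- move=> w /= nfin n _; apply: contrapT => nex; apply: nfin.
  apply: sub_finite_set (finite_II n) => t /= Yt.
  by rewrite ltnNge; apply/negP => nt; apply: nex; exists t.
apply: bigcap_measurable => // n _; exact: bigcup_measurable.
Qed.

End Walk.

(** * The expected number of boundary visits *)

(** Applied both ways, the ordering hypothesis makes the events pairwise disjoint. *)
Lemma sum_probability_le1 {R : realType} {dT : measure_display}
    {T : measurableType dT} (P : probability T R) (A : nat -> set T) (n : nat) :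
  (forall t, measurable (A t)) -> (forall s t w, A s w -> A t w -> (s <= t)%N) ->
  (\sum_(t < n) P (A t) <= 1)%E.
Proof.
move=> mA tA; rewrite -measure_bigsetU //; last first.
  move=> s t _ _ [w [As At]]; apply/eqP; rewrite eqn_leq.
  by rewrite (tA _ _ _ As At) (tA _ _ _ At As).
by apply: probability_le1; exact: bigsetU_measurable.
Qed.

Lemma measure_seq_subadditive {R : realType} {dT : measure_display}
    {T : measurableType dT} (P : {measure set T -> \bar R}) {I : eqType}
    (s : seq I) (B : I -> set T) (A : set T) :
  measurable A -> (forall i, measurable (B i)) ->
  (forall w, A w -> exists2 i, i \in s & B i w) ->
  (P A <= \sum_(i <- s) P (B i))%E.
Proof.
move=> + mB; elim: s A => [|i s ih] A mA AB.
  rewrite (_ : A = set0) ?measure0 ?big_nil //.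
  by apply/seteqP; split=> // w /AB[].
rewrite big_cons (measureDI P mA (mB i)) addeC; apply: leeD.
  by apply: le_measure; rewrite ?inE //; exact: measurableI.
apply: ih => [|w [/AB[j]]]; first exact: measurableD.
by rewrite inE => /predU1P[->|js Bj _]; [move=> /[swap]|exists j].
Qed.

Section TouchBound.
Context {V : choiceType} {e : rel V} {o : V} {G0 : subgraph e} {R : realType}.
Context {dT : measure_display} {T : measurableType dT} {P : probability T R}.
Context {F : nat -> set (set T)} {G : nat -> T -> subgraph e} {Y : nat -> T -> V}.
Hypothesis lf : locally_finite e.
Hypothesis sp : spanning G0.
Hypothesis gw : growing_walk o G0 F G Y.

(* After a boundary visit to x every edge at x is open, so that x has left the
   boundary for good. *)
Lemma OBT_touch_bound : OBT G Y ->
  forall x n, (\sum_(t < n) P (touch (G := G) (Y := Y) t x) <= 1%:E)%E.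
Proof.
move=> [_ open] x n; apply: (sum_probability_le1 P (touch (G := G) (Y := Y) ^~ x)).
  by move=> t; exact: (measurable_touch lf sp gw t x).
move=> s t w [_ bs] [Yt bt]; rewrite leqNgt; apply/negP => ts.
have atb : at_boundary G Y t w by rewrite /at_boundary Yt.
have := open t w atb; rewrite Yt => /(star_open_mono gw _ _ _ _ ts) so.
by have /(_ bs) := (boundaryE lf (vert_all sp gw s w x)).1; apply.
Qed.

Lemma past_touch (t : nat) (x : V) : past G Y t (touch (G := G) (Y := Y) t x).
Proof.
apply: (sigma_touch lf sp gw (smallest_sigma_algebra _ _)) => [y|y z];
  apply: sub_sigma_algebra; exists t; split => //.
- by apply: Or31; exists y.
- by apply: Or33; exists y, z.
Qed.

Lemma past_measurable (t : nat) : past G Y t `<=` measurable.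
Proof.
apply: smallest_sub; first exact: sigma_algebra_measurable.
move=> _ [s [_ [[x ->]|[x ->]|[x [y ->]]]]].
- exact: (measurable_at gw).
- rewrite (_ : [set _ | _] = setT) //.
  by apply/seteqP; split => w // _; exact: vert_all sp gw s w x.
- exact: (measurableF gw (edge_adapted gw s x y)).
Qed.

Lemma measurable_edge_opened (cV : countable [set: V]) (t : nat) :
  measurable (edge_opened G Y t).
Proof.
rewrite (_ : edge_opened G Y t = \bigcup_x ([set w | Y t w = x] `&`
    \bigcup_(z in [set z | e x z])
      (~` [set w | edge (G t w) x z] `&` [set w | edge (G t.+1 w) x z]))).
  apply: countable_bigcupT_measurable => // x; apply: measurableI.
    exact: (measurable_at gw).
  apply: fin_bigcup_measurable => // z _; apply: measurableI.
    exact: measurableC (measurableF gw (edge_adapted gw t x z)).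
  exact: (measurableF gw (edge_adapted gw t.+1 x z)).
apply/seteqP; split=> w /=.
  move=> [z [ez /negP nG G']]; exists (Y t w) => //; split=> //.
  by exists z.
move=> [x _ [/= <- [z ez [/negP nG G']]]]; by exists z.
Qed.

(* Each boundary visit to x opens an edge at x with probability at least eps,
   and each of the at most D edges at x is opened only once. *)
Lemma POBT_touch_bound : countable [set: V] -> bounded_degrees e -> POBT P G Y ->
  exists K : R, forall x n, (\sum_(t < n) P (touch (G := G) (Y := Y) t x) <= K%:E)%E.
Proof.
move=> cV [D degD] [_ [eps [eps0 cp]]]; exists (D%:R / eps) => x n.
pose opens z t := ~` [set w | edge (G t w) x z] `&` [set w | edge (G t.+1 w) x z].
have mopens z t : measurable (opens z t).
  apply: measurableI; first exact: measurableC (measurableF gw (edge_adapted gw t x z)).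
  exact: (measurableF gw (edge_adapted gw t.+1 x z)).
rewrite EFinM lee_pdivlMr // muleC ge0_sume_distrr //.
apply: (@le_trans _ _ (\sum_(t < n) \sum_(z <- nbrs e x) P (opens z t))%E).
  apply: lee_sum => t _; have [f [cpf ae]] := cp t.
  have mE := measurable_edge_opened cV t.
  have mt := measurable_touch lf sp gw t x.
  apply: (@le_trans _ _ (P (touch (G := G) (Y := Y) t x `&` edge_opened G Y t))).
    apply: (cond_prob_ge (smallest_sigma_algebra _ _) (past_measurable t)
      _ _ _ _ mE _ cpf).
    - exact: ltW.
    - exact: past_touch.
    - apply: filterS ae => w + [Yx bw]; rewrite /at_boundary Yx.
      by apply.
  apply: (measure_seq_subadditive P _ (opens ^~ t)) => //; first exact: measurableI.
  move=> w [[Yx _] [z []]]; rewrite Yx => xz /negP nG Gz.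
  by exists z; rewrite ?mem_nbrs.
rewrite exchange_big /=.
apply: (@le_trans _ _ (\sum_(z <- nbrs e x) 1%:E)%E).
  apply: lee_sum => z _; apply: sum_probability_le1 => // s t w [nG _] [_ Gt].
  by rewrite leqNgt; apply/negP => st; apply: nG; exact: (edge_mono gw _ _ w x z st Gt).
rewrite sumEFin lee_fin big_const_seq count_predT iter_addr_0 ler_nat.
exact: degD x.
Qed.

End TouchBound.

(** * Hitting probabilities of simple random walk *)

Lemma nat_finite_bounded (A : set nat) : finite_set A ->
  exists n, forall t, A t -> (t < n)%N.
Proof.
move=> fA; exists (\max_(t <- fset_set A) t).+1 => t At; rewrite ltnS.
by apply: leq_bigmax_seq; rewrite // in_fset_set // inE.
Qed.

Lemma probability_setI1 {R : realType} {d : measure_display} {T : measurableType d}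
    (P : probability T R) (A B : set T) :
  measurable A -> measurable B -> P A = 1%E -> P (A `&` B) = P B.
Proof.
move=> mA mB PA; rewrite (measureDI P mB mA) setIC.
rewrite [X in (X + _)%E](_ : _ = 0%E) ?add0e //.
apply/eqP; rewrite eq_le measure_ge0 andbT.
apply: (@le_trans _ _ (P (~` A))).
  by apply: le_measure; rewrite ?inE //; [exact: measurableD|exact: measurableC].
by rewrite probability_setC // PA subee.
Qed.

Section SimpleRandomWalk.
Context {V : choiceType} {e : rel V} {R : realType}.
Context {dW : measure_display} {W : measurableType dW}.
Context {Q : V -> probability W R} {X : nat -> W -> V}.
Hypothesis lf : locally_finite e.
Hypothesis conn : gconnected setT e.
Hypothesis has_edge : exists x y, e x y.
Hypothesis srw : srw_family e Q X.

Lemma sum_srw_step (x : V) : \sum_(z <- nbrs e x) srw_step e R x z = 1.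
Proof.
rewrite (eq_big_seq (fun=> (degree e x)%:R^-1)) => [|z]; last first.
  by rewrite mem_nbrs // /srw_step => ->.
rewrite big_const_seq count_predT iter_addr_0 -[size _]/(degree e x).
rewrite -[_^-1 *+ _]mulr_natl divff //.
by rewrite pnatr_eq0 -lt0n (degree_gt0 lf).
Qed.

Let cyl (n : nat) (s : nat -> V) : set W :=
  [set w | forall i, (i <= n)%N -> X i w = s i].

(** A cylinder reads only the terms of [s] up to [n]; overriding the term [n.+1] prolongs the path
    by one step. *)
Let extend (n : nat) (s : nat -> V) (z : V) : nat -> V :=
  fun i => if i == n.+1 then z else s i.

Let measurable_X n x : measurable [set w | X n w = x].
Proof. by case: srw. Qed.

Let measurable_cyl n s : measurable (cyl n s).
Proof.
rewrite (_ : cyl n s = \bigcap_(i in [set i | (i <= n)%N]) [set w | X i w = s i]) //.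
by apply: bigcap_measurable => //; exists 0%N.
Qed.

Let cyl_extend n s z :
  cyl n.+1 (extend n s z) = cyl n s `&` [set w | X n.+1 w = z].
Proof.
apply/seteqP; split=> w /=.
  move=> c; split=> [i lei|]; last by rewrite c // /extend eqxx.
  by rewrite c ?(leq_trans lei) // /extend ltn_eqF.
move=> [c xz] i; rewrite leq_eqVlt => /predU1P[->|lei].
  by rewrite /extend eqxx.
by rewrite c // /extend ltn_eqF.
Qed.

Let cyl_step y n s z :
  Q y (cyl n.+1 (extend n s z)) = (Q y (cyl n s) * (srw_step e R (s n) z)%:E)%E.
Proof.
have [_ /(_ y)[_ ->]] := srw; rewrite {2 3}/extend ltn_eqF // eqxx.
congr (Q y _ * _)%E; apply/seteqP; split => w c i lei;
  by rewrite c // /extend ltn_eqF.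
Qed.

(** The step probabilities sum to 1, so up to a null set the walk goes from [s n] to a neighbour. *)
Let cyl_split y n s (E : set W) : measurable E ->
  Q y (cyl n s `&` E) =
  (\sum_(z <- nbrs e (s n)) Q y (cyl n.+1 (extend n s z) `&` E))%E.
Proof.
move=> mE; pose N := \bigcup_(z in [set z | e (s n) z]) [set w | X n.+1 w = z].
have mN : measurable N by apply: fin_bigcup_measurable => // z _.
have sumE B : measurable B -> Q y (cyl n s `&` B `&` N) =
    (\sum_(z <- nbrs e (s n)) Q y (cyl n.+1 (extend n s z) `&` B))%E.
  move=> mB; rewrite /N setI_bigcupr measure_fin_bigcup //.
  - rewrite fsbig_finite //=; apply: eq_bigr => z _.
    by rewrite cyl_extend setIAC.
  - by move=> z z' _ _ [w [[_ /= <-] [_ /= <-]]].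
  - by move=> z _; do 2! apply: measurableI => //.
have null : Q y (cyl n s `\` N) = 0%E.
  have : Q y (cyl n s) = Q y (cyl n s `&` setT `&` N).
    rewrite sumE //.
    under eq_bigr => z _ do rewrite setIT cyl_step.
    rewrite -ge0_sume_distrr => [|z _]; last by rewrite lee_fin srw_step_ge0.
    by rewrite sumEFin sum_srw_step mule1.
  rewrite setIT => QN; have fQ := fin_num_measure (Q y) _ (measurable_cyl n s).
  rewrite measureD //; first by rewrite [X in (_ - X)%E](esym QN) subee.
  by rewrite ltey_eq fQ.
rewrite -sumE // (measureDI (Q y) (measurableI _ _ (measurable_cyl n s) mE) mN).
rewrite [X in (X + _)%E](_ : _ = 0%E) ?add0e //.
apply/eqP; rewrite eq_le measure_ge0 andbT -null; apply: le_measure; rewrite ?inE.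
- by apply: measurableD => //; exact: measurableI.
- exact: measurableD.
- by move=> w [[]].
Qed.

(** * Hitting the vertex [o]: Markov property and harmonicity *)

Context {o : V}.

Let hit (m k : nat) : set W :=
  \bigcup_(i in [set i | (m <= i <= m + k)%N]) [set w | X i w = o].

Let hit_after (m : nat) : set W :=
  \bigcup_(i in [set i | (m <= i)%N]) [set w | X i w = o].

Let measurable_hit m k : measurable (hit m k).
Proof. exact: bigcup_measurable. Qed.

Let measurable_hit_after m : measurable (hit_after m).
Proof. exact: bigcup_measurable. Qed.

(** The probability of visiting [o] within [k] steps from [y], given by first-step recursion and not
    through [Q], which makes the Markov property an induction. *)
Fixpoint hit_within (k : nat) (y : V) : R :=
  if y == o then 1 else
  if k is k'.+1 then \sum_(z <- nbrs e y) srw_step e R y z * hit_within k' z else 0.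

Let hit_within_ge0 k y : 0 <= hit_within k y.
Proof.
elim: k y => [|k ih] y /=; case: ifP => // _.
by apply: sumr_ge0 => z _; rewrite mulr_ge0 // srw_step_ge0.
Qed.

Let cyl_hit y n s k :
  Q y (cyl n s `&` hit n k) = (Q y (cyl n s) * (hit_within k (s n))%:E)%E.
Proof.
elim: k n s => [|k ih] n s; have [sno|sno] := eqVneq (s n) o.
- rewrite /= sno eqxx mule1; congr (Q y _); apply/seteqP; split => w; first by case.
  move=> c; split=> //; exists n; rewrite /= ?addn0 ?leqnn //.
  by rewrite c.
- rewrite /= (negbTE sno) mule0 (_ : _ `&` _ = set0) ?measure0 //.
  apply/seteqP; split => w // [c [i /=]]; rewrite addn0 -eqn_leq => /eqP <-.
  by rewrite c // => sno'; rewrite sno' eqxx in sno.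
- rewrite /= sno eqxx mule1; congr (Q y _); apply/seteqP; split => w; first by case.
  move=> c; split=> //; exists n; rewrite /= ?leq_addr ?leqnn //.
  by rewrite c.
rewrite cyl_split //= (negbTE sno) -sumEFin ge0_sume_distrr => [|z _]; last first.
  by rewrite lee_fin mulr_ge0 // srw_step_ge0.
apply: eq_bigr => z _; rewrite EFinM muleA -cyl_step.
have -> : hit_within k z = hit_within k (extend n s z n.+1) by rewrite /extend eqxx.
(* The path is not at [o] at time [n], so hitting within [k.+1] steps from time [n] is hitting
   within [k] steps from time [n.+1]. *)
rewrite -ih; congr (Q y _); apply/seteqP; split => w [c [i /= /andP[ni ink] io]].
  split=> //; exists i => //=; rewrite addSnnS ink andbT ltn_neqAle ni andbT.
  apply: contra_neq sno => nE; rewrite -io -nE.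
  by have := c n (leqnSn n); rewrite /extend ltn_eqF // => ->.
by split=> //; exists i => //=; rewrite -addSnnS ink (ltnW ni).
Qed.

Let cyl0 y : Q y (cyl 0 (fun=> y)) = 1%E.
Proof.
have [_ /(_ y)[<- _]] := srw; congr (Q y _).
by apply/seteqP; split => w /= => [|<-]; [apply|case].
Qed.

Definition hit_prob (y : V) : R := fine (Q y [set w | exists n, X n w = o]).

Let hit_setE : [set w | exists n, X n w = o] = hit_after 0.
Proof. by apply/seteqP; split=> w [n]; [exists n|move=> _; exists n]. Qed.

Lemma hit_probE (y : V) : (hit_prob y)%:E = Q y [set w | exists n, X n w = o].
Proof. by rewrite fineK // fin_num_measure // hit_setE. Qed.

Let hit_cvg y n s :
  (fun k => Q y (cyl n s) * (hit_within k (s n))%:E)%E @ \oo -->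
  Q y (cyl n s `&` hit_after n).
Proof.
under eq_cvg => k do rewrite -cyl_hit.
have -> : cyl n s `&` hit_after n = \bigcup_k (cyl n s `&` hit n k).
  rewrite -setI_bigcupr; congr (_ `&` _); apply/seteqP; split=> w.
    by move=> [i /= ni io]; exists i => //; exists i => //=; rewrite ni leq_addl.
  by move=> [k _ [i /= /andP[ni _] io]]; exists i.
apply: nondecreasing_cvg_mu.
- by move=> k; exact: measurableI.
- by apply: bigcup_measurable => k _; exact: measurableI.
move=> k l kl; apply/subsetPset => w [c [i /= /andP[ni ik] io]]; split => //.
by exists i => //=; rewrite ni (leq_trans ik) // leq_add2l.
Qed.

Lemma hit_within_cvg (y : V) : hit_within k y @[k --> \oo] --> hit_prob y.
Proof.
have := hit_cvg y 0%N (fun=> y); rewrite cyl0.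
rewrite probability_setI1 // -hit_setE -hit_probE.
by under eq_cvg => k do rewrite mul1e; move=> /fine_cvg.
Qed.

(** The Markov property with infinite horizon: both sides are limits of the same sequence. *)
Let cyl_hit_after y n s :
  Q y (cyl n s `&` hit_after n) = (Q y (cyl n s) * (hit_prob (s n))%:E)%E.
Proof.
apply/esym/(cvg_unique _ _ (hit_cvg y n s)) => //.
apply: cvgeZl; first exact: fin_num_measure.
by apply/cvg_EFin; [apply: nearW|exact: hit_within_cvg].
Qed.

Lemma hit_prob_ge0 (y : V) : 0 <= hit_prob y.
Proof. by rewrite -lee_fin hit_probE. Qed.

Lemma hit_prob_le1 (y : V) : hit_prob y <= 1.
Proof. by rewrite -lee_fin hit_probE; apply: probability_le1; rewrite hit_setE. Qed.

Lemma hit_prob_origin : hit_prob o = 1.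
Proof.
apply: (cvg_unique _ (hit_within_cvg o)) => //.
apply: cvg_near_cst; apply: nearW => -[|k] /=; by rewrite eqxx.
Qed.

(** The first-step recursion passes to the limit, its sum being finite. *)
Lemma hit_prob_harmonic (y : V) : y != o ->
  hit_prob y = \sum_(z <- nbrs e y) srw_step e R y z * hit_prob z.
Proof.
move=> yo; have : hit_within k.+1 y @[k --> \oo] --> hit_prob y.
  by rewrite (cvg_shiftS (hit_within ^~ y)); exact: hit_within_cvg.
move=> /(cvg_unique _); apply => //=; under eq_cvg => k do rewrite (negbTE yo).
apply: cvg_big => [|z _]; first exact: add_continuous.
by apply: cvgMl_tmp; exact: hit_within_cvg.
Qed.

(** An average with positive weights of values at most 1 cannot reach 1 if one of them is
    smaller. *)
Let mean_eq1 (y z : V) :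
  1 <= \sum_(z <- nbrs e y) srw_step e R y z * hit_prob z -> e y z -> hit_prob z = 1.
Proof.
move=> m1 yz; apply/eqP; rewrite eq_le hit_prob_le1 leNgt /=; apply/negP => lt1.
move: m1; apply/negP; rewrite -ltNge -[ltRHS](sum_srw_step y).
have zn : z \in nbrs e y by rewrite mem_nbrs.
rewrite (big_rem z zn) [ltRHS](big_rem z zn) /=; apply: ltr_leD.
  rewrite gtr_pMr // /srw_step yz invr_gt0 ltr0n; exact: degree_gt0.
apply: ler_sum => u _.
by rewrite ler_piMr ?hit_prob_le1 // srw_step_ge0.
Qed.

Hypothesis trans : {ae Q o, forall w, transient_path o (X ^~ w)}.

(* Otherwise hit_prob would be constantly 1, by the maximum principle along a
   path from o, and the Markov property would give infinitely many visits to
   o almost surely. *)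
Lemma return_prob_lt1 : \sum_(z <- nbrs e o) srw_step e R o z * hit_prob z < 1.
Proof.
rewrite ltNge; apply/negP => m1.
have h1 y : hit_prob y = 1.
  have [p [pp <-]] := conn o y I I.
  elim/last_ind: p pp => [|p z ih]; first by rewrite hit_prob_origin.
  rewrite rcons_path last_rcons => /andP[/ih hl]; apply: mean_eq1.
  have [->//|lo] := eqVneq (last o p) o.
  by rewrite -hit_prob_harmonic // hl.
(* The cylinder is split over its next [k] steps, and from each endpoint [o] is hit almost
   surely. *)
have cyl_recur n s k : Q o (cyl n s `&` hit_after (n + k)) = Q o (cyl n s).
  elim: k n s => [|k ih] n s; first by rewrite addn0 cyl_hit_after h1 mule1.
  rewrite cyl_split // -[in RHS](setIT (cyl n s)) cyl_split //.
  by apply: eq_bigr => z _; rewrite addnS -addSn ih setIT.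
have recur k : Q o (hit_after k) = 1%E.
  rewrite -(probability_setI1 _ _ _ _ _ (cyl0 o)) //.
  by rewrite -(cyl0 o) -[in LHS](add0n k) cyl_recur.
have ae_recur : {ae Q o, forall w, forall k, hit_after k w}.
  apply: ae_foralln => k; exists (~` hit_after k); split => //.
    exact: measurableC.
  by rewrite [LHS](probability_setC (Q o)) ?recur ?subee.
(* Almost every path would visit [o] both finitely and infinitely often. *)
have : Q o setT = 0%E.
  apply: measure_negligible => //.
  apply: negligibleS (filterI trans ae_recur) => w _ /= [fin rec].
  have [n bnd] := nat_finite_bounded _ fin.
  by have [t /= nt to] := rec n; have := bnd t to; rewrite ltnNge nt.
by rewrite probability_setT => /eqP; rewrite onee_eq0.
Qed.

End SimpleRandomWalk.

(** * The lattice *)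

Section LatticeGraph.
Context {d : nat}.
Implicit Types x y z : 'rV[int]_d.

Definition l1norm x : nat := (\sum_(i < d) `|x 0%R i|)%N.

(** The [2 d] signed unit vectors; the boolean [true] stands for the minus sign. *)
Definition unit_step (p : 'I_d * bool) : 'rV[int]_d :=
  \row_j (if j == p.1 then (-1) ^+ p.2 else 0).

Lemma zadjE x y : zadj x y = (l1norm (x - y) == 1)%N.
Proof.
rewrite /zadj /l1norm -eqz_nat; congr (_ == _).
rewrite [RHS](big_morph Posz PoszD (erefl : Posz 0 = 0)).
by apply: eq_bigr => i _; rewrite !mxE abszE.
Qed.

Lemma l1normN x : l1norm (- x) = l1norm x.
Proof. by apply: eq_bigr => i _; rewrite mxE abszN. Qed.

Lemma l1norm_eq0 x : l1norm x = 0%N -> x = 0.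
Proof.
move/eqP; rewrite sum_nat_eq0 => /forallP x0; apply/rowP => i.
by have := x0 i; rewrite absz_eq0 mxE => /eqP.
Qed.

Lemma l1norm_triangle x y : (l1norm (x + y) <= l1norm x + l1norm y)%N.
Proof.
rewrite /l1norm -big_split; apply: leq_sum => i _ /=.
by rewrite mxE -lez_nat PoszD !abszE ler_normD.
Qed.

Lemma l1norm_unit_step x i :
  x 0 i != 0 -> l1norm x = (l1norm (x - unit_step (i, (x 0 i < 0)%R))).+1.
Proof.
move=> xi; rewrite /l1norm (bigD1 i) //= [in RHS](bigD1 i) //= !mxE eqxx.
rewrite -addSn; congr (_ + _)%N; last first.
  apply: eq_bigr => j ji; rewrite !mxE /= (negbTE ji) subr0 //.
by case: ltP => xi0 /=; lia.
Qed.

Lemma unit_step_inj : injective unit_step.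
Proof.
move=> [i b] [j c] /rowP eq; have := eq i; rewrite !mxE /= eqxx.
case: eqVneq => [<-|_]; last by case: (b).
by case: b {eq} => /=; case: c.
Qed.

Lemma l1norm1P z : l1norm z = 1%N -> exists p, z = unit_step p.
Proof.
move=> z1; have [i zi] : exists i, z 0 i != 0.
  apply/existsP; apply: contra_eqT z1 => /existsPn z0.
  by rewrite /l1norm big1 // => i _; have := z0 i; rewrite negbK => /eqP ->.
exists (i, (z 0 i < 0)%R); apply/eqP; rewrite -subr_eq0; apply/eqP.
by apply: l1norm_eq0; move: (l1norm_unit_step z i zi); rewrite z1 => -[].
Qed.

Lemma l1norm_unit p : l1norm (unit_step p) = 1%N.
Proof.
rewrite /l1norm (bigD1 p.1) //= big1 => [|j jp]; last first.
  by rewrite mxE (negbTE jp).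
by rewrite mxE eqxx; case: p.2.
Qed.

Lemma zadj_unit_stepP x y : reflect (exists p, y = x + unit_step p) (zadj x y).
Proof.
rewrite zadjE -l1normN opprB; apply: (iffP eqP) => [/l1norm1P[p yx]|[p ->]].
  by exists p; rewrite -yx addrC subrK.
by rewrite addrAC subrr add0r l1norm_unit.
Qed.

Lemma zadj_locally_finite : locally_finite (@zadj d).
Proof.
move=> x; apply: (@sub_finite_set _ _ ((fun p => x + unit_step p) @` setT)).
  by move=> y /= /zadj_unit_stepP[p ->]; exists p.
exact/finite_image/finite_finset.
Qed.

Lemma zadj_nbrs x : perm_eq (nbrs (@zadj d) x) [seq x + unit_step p | p : 'I_d * bool].
Proof.
apply: uniq_perm; first exact: fset_uniq.
  by rewrite map_inj_uniq ?enum_uniq // => p q /addrI/unit_step_inj.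
move=> y; rewrite (mem_nbrs zadj_locally_finite).
apply/zadj_unit_stepP/mapP => [[p ->]|[p _ ->]]; exists p => //.
by rewrite mem_enum.
Qed.

Lemma zadj_degree x : degree (@zadj d) x = (d * 2)%N.
Proof.
rewrite -[LHS]/(size (nbrs (@zadj d) x)) (perm_size (zadj_nbrs x)) size_map -cardE.
by rewrite card_prod card_ord card_bool.
Qed.

Lemma zadj_mean (R : realType) (f : 'rV[int]_d -> R) x :
  \sum_(z <- nbrs (@zadj d) x) srw_step (@zadj d) R x z * f z =
  (\sum_(i < d) (f (x + unit_step (i, false)) + f (x + unit_step (i, true)))) /
    (d * 2)%:R.
Proof.
rewrite (perm_big _ (zadj_nbrs x)) big_map big_enum /= mulr_suml.
rewrite -(pair_bigA _ (fun i b =>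
  srw_step (@zadj d) R x (x + unit_step (i, b)) * f (x + unit_step (i, b)))) /=.
apply: eq_bigr => i _; rewrite big_bool /= /srw_step zadj_degree.
have adj b : zadj x (x + unit_step (i, b)) by apply/zadj_unit_stepP; exists (i, b).
by rewrite !adj -mulrDr mulrC addrC.
Qed.

(** Greedy walk: as long as some coordinate differs, step along it towards [y]. *)
Lemma zadj_walk x y :
  exists p, [/\ path (@zadj d) x p, last x p = y & size p = l1norm (y - x)].
Proof.
move: {2}(l1norm _) (erefl (l1norm (y - x))) => n.
elim: n x => [|n ih] x yx.
  exists [::]; split => //=; rewrite ?yx //.
  by move/l1norm_eq0/eqP: yx; rewrite subr_eq0 => /eqP ->.
have [i zi] : exists i, (y - x) 0 i != 0.
  apply/existsP; apply: contra_eqT yx => /existsPn z0.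
  by rewrite /l1norm big1 // => i _; have := z0 i; rewrite negbK => /eqP ->.
have := l1norm_unit_step _ i zi; set u := unit_step _; rewrite yx => -[nE].
have yxu : y - (x + u) = y - x - u by rewrite opprD addrA.
have [|p [pp lp sp]] := ih (x + u); first by rewrite yxu -nE.
exists ((x + u) :: p); split=> //=; last by rewrite sp yxu -nE.
by rewrite pp andbT; apply/zadj_unit_stepP; exists (i, ((y - x) 0 i < 0)%R).
Qed.

Lemma l1norm_le_size x (p : seq 'rV[int]_d) :
  path (@zadj d) x p -> (l1norm (last x p - x) <= size p)%N.
Proof.
elim: p x => [|y p ih] x /=; first by rewrite subrr /l1norm big1 // => i _; rewrite mxE.
rewrite zadjE => /andP[/eqP xy /ih le].
apply: leq_trans (_ : l1norm (last y p - y) + l1norm (y - x) <= _)%N.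
  by apply: leq_trans (l1norm_triangle _ _); rewrite addrA subrK.
by rewrite -[l1norm (y - x)]l1normN opprB xy addn1.
Qed.

Lemma zadj_gdist x y : gdist (@zadj d) x y = l1norm (y - x).
Proof.
have [p [pp lp sp]] := zadj_walk x y.
apply/eqP; rewrite eqn_leq; apply/andP; split.
  by rewrite -sp -{1}lp gdist_le_size.
have [|q [qq <- <-]] := gdist_walk (e := @zadj d) x y; first by exists p.
exact: l1norm_le_size.
Qed.

Lemma zadj_connected : gconnected setT (@zadj d).
Proof. by move=> x y _ _; have [p [pp lp _]] := zadj_walk x y; exists p. Qed.

End LatticeGraph.

(** * A superharmonic function on the lattice *)

Section InverseSqrtExpansion.
Context {R : realType}.
Implicit Types v t u : R.

(** Template for majorants of [(1 + v)^(- m / 2)] near 0. The signs alternate as in the binomial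
    series, so that the coefficients used are nonnegative; [k] absorbs the remainder. *)
Definition quartic (a b c k v : R) : R :=
  1 - a * v + b * v ^+ 2 - c * v ^+ 3 + k * v ^+ 4.

(** After squaring, the claim is [p^2 (1 + v) >= 1]. The cubic Taylor polynomial [q] leaves an error
    of order [v^4], which the generous coefficient 2 (35/128 in the Taylor series) outweighs. *)
Lemma inv_sqrt_le_quartic v : `|v| <= 1 / 2 ->
  (Num.sqrt (1 + v))^-1 <= quartic (1 / 2) (3 / 8) (5 / 16) 2 v.
Proof.
rewrite ler_norml => /andP[v1 v2]; set p := quartic _ _ _ _ _.
have v1p : 0 < 1 + v by lra.
have w0 : 0 <= v ^+ 2 by exact: sqr_ge0.
have w1 : v ^+ 2 <= 1 / 4 by rewrite expr2; nra.
pose q := 1 - v / 2 + 3 / 8 * v ^+ 2 - 5 / 16 * v ^+ 3.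
have q0 : 1 / 2 <= q.
  rewrite /q exprS; have : v * v ^+ 2 <= 1 / 8 by nra.
  by lra.
have pE : p = q + 2 * (v ^+ 2) ^+ 2 by rewrite /p /q /quartic; ring.
have p0 : 0 < p by rewrite pE; have := sqr_ge0 (v ^+ 2); lra.
have key : 1 <= p ^+ 2 * (1 + v).
  have -> : p ^+ 2 * (1 + v) = 1 + (v ^+ 2) ^+ 2 *
     (- (35 / 64) + 14 / 64 * v - 35 / 256 * v ^+ 2 + 25 / 256 * (v * v ^+ 2)
      + 4 * (q * (1 + v)) + 4 * (v ^+ 2) ^+ 2 * (1 + v)).
    by rewrite pE /q; field.
  rewrite lerDl; apply: mulr_ge0; first exact: sqr_ge0.
  have h1 : 1 / 4 <= q * (1 + v) by nra.
  have h2 : 0 <= (v ^+ 2) ^+ 2 * (1 + v) by apply: mulr_ge0; [exact: sqr_ge0|lra].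
  have h3 : - (1 / 8) <= v * v ^+ 2 by nra.
  by lra.
rewrite -[leLHS]mul1r ler_pdivrMr ?sqrtr_gt0 //.
rewrite -(@ler_sqr _ 1) ?nnegrE ?mulr_ge0 ?sqrtr_ge0 ?(ltW p0) //.
by rewrite expr1n exprMn sqr_sqrtr // ltW.
Qed.

(** Coefficients up to degree three multiply exactly. The terms of degree four to eight share a
    factor [v^4], and since [|v| <= 1] their coefficients are added up in the last one. *)
Lemma mul_quartic_le (a b c k a' b' c' k' v : R) :
  0 <= a -> 0 <= b -> 0 <= c -> 0 <= k ->
  0 <= a' -> 0 <= b' -> 0 <= c' -> 0 <= k' -> `|v| <= 1 ->
  quartic a b c k v * quartic a' b' c' k' v <=
  quartic (a + a') (b + a * a' + b') (c + b * a' + a * b' + c')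
    (k + k' + a * c' + c * a' + b * b' + (a * k' + b * c' + c * b' + k * a') +
     (b * k' + c * c' + k * b') + (c * k' + k * c') + k * k') v.
Proof.
move=> a0 b0 c0 k0 a'0 b'0 c'0 k'0 v1.
have -> : quartic a b c k v * quartic a' b' c' k' v =
  1 - (a + a') * v + (b + a * a' + b') * v ^+ 2
   - (c + b * a' + a * b' + c') * v ^+ 3 +
   ((k + k' + a * c' + c * a' + b * b') - (a * k' + b * c' + c * b' + k * a') * v +
    (b * k' + c * c' + k * b') * v ^+ 2 - (c * k' + k * c') * v ^+ 3 +
    (k * k') * v ^+ 4) * v ^+ 4 by rewrite /quartic; ring.
rewrite /quartic lerD2l ler_wpM2r ?exprn_even_ge0 //.
have vn n : - 1 <= v ^+ n <= 1 by rewrite -ler_norml normrX exprn_ile1.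
have bnd (x y : R) : 0 <= x -> - 1 <= y <= 1 -> x * y <= x /\ - (x * y) <= x.
  by move=> x0 /andP[y1 y2]; split; nra.
have [|_ h1] := bnd (a * k' + b * c' + c * b' + k * a') v _ (vn 1%N).
  by rewrite !addr_ge0 ?mulr_ge0.
have [|h2 _] := bnd (b * k' + c * c' + k * b') _ _ (vn 2%N).
  by rewrite !addr_ge0 ?mulr_ge0.
have [|_ h3] := bnd (c * k' + k * c') _ _ (vn 3%N).
  by rewrite !addr_ge0 ?mulr_ge0.
have [|h4 _] := bnd (k * k') _ _ (vn 4%N); first by rewrite ?mulr_ge0.
by lra.
Qed.

(* Up to degree two the bound is the Taylor expansion of (1 + v)^(- m / 2), as
   superharmonicity requires; of the cubic term only the sign matters. *)
Lemma inv_sqrt_expr_le_quartic (m : nat) : exists c k : R, [/\ 0 <= c, 0 <= k &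
  forall v, `|v| <= 1 / 2 -> (Num.sqrt (1 + v))^-1 ^+ m <=
    quartic (m%:R / 2) (m%:R * (m%:R + 2) / 8) c k v].
Proof.
elim: m => [|m [c [k [c0 k0 ih]]]].
  exists 0, 0; split => // v _.
  by rewrite expr0 /quartic !mul0r !subr0 !addr0.
pose a : R := m%:R / 2; pose b : R := m%:R * (m%:R + 2) / 8.
have a0 : 0 <= a by rewrite /a divr_ge0.
have b0 : 0 <= b by rewrite /b divr_ge0 // mulr_ge0 // addr_ge0.
have [h2 h3 h5] : [/\ 0 <= 1 / 2 :> R, 0 <= 3 / 8 :> R & 0 <= 5 / 16 :> R].
  by split; lra.
have le := mul_quartic_le a b c k (1 / 2) (3 / 8) (5 / 16) 2 _
  a0 b0 c0 k0 h2 h3 h5 (ler0n R 2).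
(* The cubic and quartic coefficients that [mul_quartic_le] gives for the product of the majorants
   for exponents [m] and 1. *)
exists (c + b * (1 / 2) + a * (3 / 8) + 5 / 16).
exists (k + 2 + a * (5 / 16) + c * (1 / 2) + b * (3 / 8) +
  (a * 2 + b * (5 / 16) + c * (3 / 8) + k * (1 / 2)) +
  (b * 2 + c * (5 / 16) + k * (3 / 8)) + (c * 2 + k * (5 / 16)) + k * 2).
split=> [||v v1]; [by rewrite !addr_ge0 // mulr_ge0|by rewrite !addr_ge0 // mulr_ge0|].
rewrite exprSr; apply: (@le_trans _ _ (quartic a b c k v *
    quartic (1 / 2) (3 / 8) (5 / 16) 2 v)).
  by apply: ler_pM; rewrite ?exprn_ge0 ?invr_ge0 ?sqrtr_ge0 ?ih ?inv_sqrt_le_quartic.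
have v1' : `|v| <= 1 by lra.
apply: le_trans (le v v1') _.
have -> : a + 1 / 2 = m.+1%:R / 2 by rewrite /a -natr1; field.
have -> // : b + a * (1 / 2) + 3 / 8 = m.+1%:R * (m.+1%:R + 2) / 8.
by rewrite /a /b -natr1; field.
Qed.

End InverseSqrtExpansion.

(** Odd powers of [t] cancel, and the cubic part has a favourable sign. With [t^2 <= 4 u] and
    [u <= 1] the fourth-order part is at most [(1 + 24 + 16) u^2 = 41 u^2]. *)
Lemma quartic_pair_le {R : realType} (a b c k u t : R) :
  0 <= c -> 0 <= k -> 0 <= u <= 1 -> t ^+ 2 <= 4 * u ->
  quartic a b c k (u + t) + quartic a b c k (u - t) <=
  2 - 2 * a * u + 2 * b * (u ^+ 2 + t ^+ 2) + 82 * k * u ^+ 2.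
Proof.
move=> c0 k0 /andP[u0 u1] tu; have t0 : 0 <= t ^+ 2 by exact: sqr_ge0.
have -> : quartic a b c k (u + t) + quartic a b c k (u - t) =
  2 - 2 * a * u + 2 * b * (u ^+ 2 + t ^+ 2) - 2 * (c * (u ^+ 3 + 3 * (u * t ^+ 2))) +
  2 * (k * ((u ^+ 2) ^+ 2 + 6 * (u ^+ 2 * t ^+ 2) + (t ^+ 2) ^+ 2)).
  by rewrite /quartic; ring.
have h1 : 0 <= c * (u ^+ 3 + 3 * (u * t ^+ 2)).
  by rewrite mulr_ge0 // addr_ge0 ?exprn_ge0 // mulr_ge0 // mulr_ge0.
have h2 : k * ((u ^+ 2) ^+ 2 + 6 * (u ^+ 2 * t ^+ 2) + (t ^+ 2) ^+ 2) <=
    k * (41 * u ^+ 2).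
  rewrite ler_wpM2l //; move: (t ^+ 2) t0 tu => w t0 tu.
  have q0 : 0 <= u ^+ 2 by exact: sqr_ge0.
  have q1 : u ^+ 2 <= 1 by rewrite exprn_ile1.
  have e1 : (u ^+ 2) ^+ 2 <= u ^+ 2 by rewrite [leLHS]expr2 ler_piMl.
  have e2 : u ^+ 2 * w <= u ^+ 2 * 4 by rewrite ler_wpM2l //; lra.
  have e3 : w ^+ 2 <= (4 * u) ^+ 2 by rewrite ler_sqr ?nnegrE //; lra.
  by rewrite exprMn in e3; lra.
by lra.
Qed.

Section LatticePotential.
Context {R : realType} {d : nat}.
Implicit Types x y z : 'rV[int]_d.

Definition sqnorm x : R := \sum_(i < d) (x 0 i)%:~R ^+ 2.

Definition potential (A : R) (m : nat) x : R := (Num.sqrt (sqnorm x + A))^-1 ^+ m.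

Lemma sqnorm_ge0 x : 0 <= sqnorm x.
Proof. by apply: sumr_ge0 => i _; exact: sqr_ge0. Qed.

Lemma sqr_coord_le_sqnorm x i : (x 0 i)%:~R ^+ 2 <= sqnorm x.
Proof.
by rewrite /sqnorm (bigD1 i) //= lerDl sumr_ge0 // => j _; exact: sqr_ge0.
Qed.

Lemma sqnorm_unit_step x i (b : bool) :
  sqnorm (x + unit_step (i, b)) = sqnorm x + (-1) ^+ b * (2 * (x 0 i)%:~R) + 1.
Proof.
rewrite /sqnorm (bigD1 i) //= [in RHS](bigD1 i) //= !mxE eqxx.
rewrite (eq_bigr (fun j => (x 0 j)%:~R ^+ 2)) => [|j ji]; last first.
  by rewrite !mxE /= (negbTE ji) addr0.
by rewrite rmorphD /=; case: b; rewrite ?expr1 ?expr0 ?rmorphN /=; ring.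
Qed.

Lemma potential_ge0 A m x : 0 <= potential A m x.
Proof. by rewrite exprn_ge0 // invr_ge0 sqrtr_ge0. Qed.

Lemma potential_gt0 A m x : 0 < A -> 0 < potential A m x.
Proof.
by move=> A0; rewrite exprn_gt0 // invr_gt0 sqrtr_gt0 ltr_wpDl // sqnorm_ge0.
Qed.

End LatticePotential.

(* The continuum function (|x|^2 + A)^(- m / 2), m = d - 2, has Laplacian
   - m d A (|x|^2 + A)^(- (d + 2) / 2), and the error made by the discrete
   Laplacian is of the same order in x; hence a large A works. *)
Lemma potential_superharmonic {R : realType} (m : nat) : (0 < m)%N ->
  exists2 A : R, 0 < A & forall x : 'rV[int]_(m.+2),
    \sum_(z <- nbrs (@zadj m.+2) x) srw_step (@zadj m.+2) R x z * potential A m z <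
    potential A m x.
Proof.
move=> m0; have [c [k [c0 k0 psi_le]]] := inv_sqrt_expr_le_quartic (R := R) m.
set a : R := m%:R / 2 in psi_le; set b : R := m%:R * (m%:R + 2) / 8 in psi_le.
have b0 : 0 <= b by rewrite /b divr_ge0 // mulr_ge0 // addr_ge0.
(* The last two terms make the final coefficient [2 b + 82 k - m A] negative; 64 keeps [u + t i] and
   [u - t i] within the range [[-1/2, 1/2]] of the expansion. *)
pose A : R := 64 + 2 * b + 82 * k.
have A64 : 64 <= A by rewrite /A; lra.
exists A => [|x]; first by lra.
pose rho : R := sqnorm x + A; pose u := rho^-1.
have rhoA : A <= rho by rewrite lerDr sqnorm_ge0.
have rho0 : 0 < rho by lra.
have u0 : 0 < u by rewrite invr_gt0.
have urho : u * rho = 1 by rewrite mulVf // gt_eqF.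
have u64 : u <= 1 / 64.
  by rewrite -(ler_pM2r rho0) urho; lra.
(* At the two neighbours in direction [i], [sqnorm] plus [A] equals [rho (1 + u + t i)] and
   [rho (1 + u - t i)]. *)
pose t i : R := 2 * (x 0 i)%:~R * u.
have t_sqr i : t i ^+ 2 = 4 * u ^+ 2 * (x 0 i)%:~R ^+ 2 by rewrite /t; ring.
have t_le i : t i ^+ 2 <= 4 * u.
  rewrite t_sqr; apply: (@le_trans _ _ (4 * u ^+ 2 * rho)).
    apply: ler_wpM2l; first by rewrite mulr_ge0 // sqr_ge0.
    by have := sqr_coord_le_sqnorm (R := R) x i; rewrite /rho; lra.
  have -> : 4 * u ^+ 2 * rho = 4 * u * (u * rho) by ring.
  by rewrite urho mulr1.
have sum_t : \sum_(i < m.+2) t i ^+ 2 = 4 * u - 4 * A * u ^+ 2.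
  under eq_bigr do rewrite t_sqr.
  rewrite -mulr_sumr -/(sqnorm x) (_ : sqnorm x = rho - A); last by rewrite /rho; ring.
  have -> : 4 * u ^+ 2 * (rho - A) = 4 * u * (u * rho) - 4 * A * u ^+ 2 by ring.
  by rewrite urho mulr1.
have t_small i : `|t i| <= 1 / 4.
  by rewrite -ler_sqr ?nnegrE // ?real_normK ?num_real //; have := t_le i; lra.
pose psi (v : R) := (Num.sqrt (1 + v))^-1 ^+ m.
have pot_step i (s : bool) :
    potential A m (x + unit_step (i, s)) = potential A m x * psi (u + (-1) ^+ s * t i).
  rewrite /potential sqnorm_unit_step /psi -exprMn -invfM -sqrtrM ?ltW // -/rho.
  congr ((Num.sqrt _)^-1 ^+ m); rewrite [RHS]mulrDr mulr1 mulrDr [rho * u]mulrC urho.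
  have -> : rho * ((-1) ^+ s * t i) = (-1) ^+ s * (2 * (x 0 i)%:~R) * (u * rho).
    by rewrite /t; ring.
  by rewrite urho /rho; ring.
rewrite zadj_mean ltr_pdivrMr ?ltr0n ?muln_gt0 //.
have -> : \sum_(i < m.+2) (potential A m (x + unit_step (i, false)) +
      potential A m (x + unit_step (i, true))) =
    potential A m x * \sum_(i < m.+2) (psi (u + t i) + psi (u - t i)).
  rewrite mulr_sumr; apply: eq_bigr => i _.
  by rewrite !pot_step expr0 expr1 mul1r mulN1r mulrDr.
rewrite ltr_pM2l; last by apply: potential_gt0; lra.
apply: (@le_lt_trans _ _ (\sum_(i < m.+2)
    (2 - 2 * a * u + 2 * b * u ^+ 2 + 82 * k * u ^+ 2 + 2 * b * t i ^+ 2))).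
  apply: ler_sum => i _.
  apply: le_trans (_ : quartic a b c k (u + t i) + quartic a b c k (u - t i) <= _).
    have := t_small i; rewrite ler_norml => /andP[t1 t2].
    by apply: lerD; apply: psi_le; rewrite ler_norml; apply/andP; split; lra.
  have u01 : 0 <= u <= 1 by apply/andP; split; lra.
  by have := quartic_pair_le a b c k u (t i) c0 k0 u01 (t_le i); lra.
rewrite big_split /= -mulr_sumr sum_t sumr_const card_ord -[_ *+ _]mulr_natl.
have m1 : 1 <= m%:R :> R by rewrite ler1n.
have -> : (m.+2 * 2)%:R = (m%:R + 2) * 2 :> R by rewrite natrM -addn2 natrD.
have -> : m.+2%:R = m%:R + 2 :> R by rewrite -addn2 natrD.
have uu : 0 < u ^+ 2 by rewrite exprn_gt0.
(* The terms linear in [u] cancel because [(m + 2) a = 4 b], which reflects the harmonicity of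
   [|x|^(- m)] in dimension [m + 2]; a multiple of [u^2] is left. *)
have -> : (m%:R + 2) * (2 - 2 * a * u + 2 * b * u ^+ 2 + 82 * k * u ^+ 2) +
    2 * b * (4 * u - 4 * A * u ^+ 2) =
  (m%:R + 2) * 2 + (m%:R + 2) * u ^+ 2 * (2 * b + 82 * k - m%:R * A) :> R.
  by rewrite /a /b; field.
rewrite gtrDl pmulr_rlt0; last by rewrite mulr_gt0 // addr_gt0 // ltr0n.
have : A <= m%:R * A by rewrite ler_peMl //; lra.
by rewrite /A; lra.
Qed.

(** * Boxes and the sum over the boundary *)

Section BoxBoundary.
Context {d : nat}.
Implicit Types x y : 'rV[int]_d.

(** Twice the supremum norm: the side of the centred box with [x] on its boundary. It is even, as
    boxes of odd side have no lattice point on theirs. *)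
Definition box_side x : nat := (2 * \max_(i < d) `|x 0%R i|)%N.

Let coord_le (x : 'rV[int]_d) i k :
  (`|(x 0 i)%:Q| <= k%:R / 2) = (2 * `|x 0%R i| <= k)%N.
Proof.
by rewrite ler_pdivlMr // -intr_norm -abszE pmulrn -!natrM ler_nat mulnC.
Qed.

Lemma box_boundaryP k x : (0 < d)%N -> box_boundary k x <-> box_side x = k.
Proof.
move=> d0; have coord_side i : (2 * `|x 0%R i| <= box_side x)%N.
  by rewrite leq_mul2l /= (leq_bigmax i).
split=> [[le [i eq]]|<-]; last first.
  split=> [i|]; first by rewrite coord_le.
  have cd : (0 < #|'I_d|)%N by rewrite card_ord.
  have [i maxE] := bigop.eq_bigmax (fun i => `|x 0%R i|%N) cd.
  exists i; apply/eqP; rewrite eq_le coord_le coord_side /=.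
  by rewrite /box_side maxE natrM mulrAC mulfV // mul1r -intr_norm -abszE.
apply/eqP; rewrite eqn_leq; apply/andP; split.
  rewrite /box_side mulnC -leq_divRL //; apply/bigmax_leqP => j _.
  by rewrite leq_divRL // mulnC -coord_le.
apply: leq_trans (coord_side i).
move: eq; rewrite -intr_norm -abszE => eq.
have {}eq : `|x 0%R i|%N%:R = k%:R / 2 :> rat := eq.
by rewrite -(ler_nat rat) natrM eq mulrCA mulfV // mulr1.
Qed.

(** Finiteness makes [boundary_count] a true count. Coordinates are shifted by [k] and encoded as
    naturals up to [2 k]. *)
Lemma finite_box_boundary k : finite_set (@box_boundary d k).
Proof.
pose f (g : {ffun 'I_d -> 'I_(k + k).+1}) : 'rV[int]_d := \row_i ((g i)%:Z - k%:Z).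
apply: (@sub_finite_set _ _ (f @` setT)); last exact/finite_image/finite_finset.
move=> x [le _]; exists [ffun i => inord (absz (x 0 i + k%:Z)%R)] => //.
apply/rowP => i; rewrite !mxE ffunE.
have := le i; rewrite coord_le => xk.
by rewrite inordK; lia.
Qed.

Lemma box_side_gt0 x : x != 0 -> (0 < box_side x)%N.
Proof.
apply: contra_neqT; rewrite lt0n negbK muln_eq0 /= => /eqP max0.
apply/rowP => i; rewrite mxE; apply/eqP; rewrite -absz_eq0 -leqn0 -[leqRHS]max0.
exact: (leq_bigmax i).
Qed.

Lemma box_side_le_l1norm x : (box_side x <= 2 * l1norm x)%N.
Proof.
rewrite leq_mul2l /=; apply/bigmax_leqP => i _.
by rewrite /l1norm (bigD1 i) //= leq_addr.
Qed.

Lemma l1norm_le_sqrt_sqnorm (R : realType) x :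
  (l1norm x)%:R <= d%:R * Num.sqrt (sqnorm x : R).
Proof.
rewrite /l1norm natr_sum -[X in X%:R * _]card_ord mulr_natl -sumr_const.
apply: ler_sum => i _; rewrite -[leLHS]ger0_norm // -sqrtr_sqr ler_wsqrtr //.
apply: le_trans (sqr_coord_le_sqnorm (R := R) x i).
by rewrite pmulrn abszE intr_norm real_normK ?num_real.
Qed.

End BoxBoundary.

(** By the triangle inequality the l1 norm of [y] is at least [1 - c] times that of [x], hence at
    least [(1 - c) / 2] times [box_side x]; and it is at most the dimension times the Euclidean norm
    of [y]. *)
Lemma potential_jump_le {R : realType} {m : nat} {A c : R} {x y : 'rV[int]_m.+2} :
  0 < A -> c < 1 -> x != 0 ->
  (gdist (@zadj m.+2) x y)%:R <= c * (gdist (@zadj m.+2) x 0)%:R ->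
  potential A m y <=
  ((1 - c) / (2 * m.+2%:R))^-1 ^+ m * (box_side x)%:R^-1 ^+ m.
Proof.
move=> A0 c1 x0; rewrite !zadj_gdist sub0r l1normN => le.
have k0 : 0 < (box_side x)%:R :> R by rewrite ltr0n box_side_gt0.
rewrite -exprMn -invfM /potential lerXn2r ?nnegrE ?invr_ge0 ?sqrtr_ge0 //.
  by rewrite mulr_ge0 ?(ltW k0) // divr_ge0 ?mulr_ge0 // subr_ge0 ltW.
rewrite lef_pV2 ?posrE ?sqrtr_gt0; last 2 first.
- by rewrite ltr_wpDl // sqnorm_ge0.
- by rewrite mulr_gt0 // divr_gt0 ?mulr_gt0 // subr_gt0.
rewrite mulrAC ler_pdivrMr ?mulr_gt0 //.
have tri : (l1norm x)%:R <= (l1norm y)%:R + (l1norm (y - x))%:R :> R.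
  rewrite -natrD ler_nat -[l1norm (y - x)]l1normN opprB.
  by have := l1norm_triangle y (x - y); rewrite addrC subrK.
have side : (1 - c) * (box_side x)%:R <= (1 - c) * (2 * (l1norm x)%:R).
  rewrite ler_wpM2l ?subr_ge0 ?(ltW c1) // -natrM ler_nat.
  exact: box_side_le_l1norm.
have ly := l1norm_le_sqrt_sqnorm R y.
have sq : m.+2%:R * Num.sqrt (sqnorm y) <= m.+2%:R * Num.sqrt (sqnorm y + A).
  by rewrite ler_wpM2l // ler_wsqrtr // lerDl ltW.
by lra.
Qed.

(** Grouped by [box_side], the boundary contributes [C N(k) k^(- m)] for each [k], with
    [m = d - 2]. *)
Lemma boundary_esum_lt_pinfty {R : realType} {m : nat}
    (G0 : subgraph (@zadj m.+2)) (C : R) : (0 < m)%N -> 0 <= C ->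
  (\sum_(1 <= k <oo)
     ((boundary_count G0 k)%:R * (k%:R : R) ^ (2%:Z - m.+2%:Z))%:E < +oo)%E ->
  (\esum_(x in boundary G0) (C * (box_side x)%:R^-1 ^+ m)%:E < +oo)%E.
Proof.
move=> m0 C0 fin; pose J k := boundary G0 `&` box_boundary k.
have finJ k : finite_set (J k) by exact: finite_setIr (finite_box_boundary k).
have -> : boundary G0 = \bigcup_k J k.
  apply/seteqP; split=> [x bx|x [k _ []] //].
  by exists (box_side x) => //; split=> //; apply/box_boundaryP.
rewrite nneseries_sum_bigcup; last 2 first.
- move=> k l _ _ [x [[_ /(box_boundaryP _ _ (ltn0Sn _)) <-]]].
  by move=> [_ /(box_boundaryP _ _ (ltn0Sn _))].
- by move=> x; rewrite lee_fin mulr_ge0 // exprn_ge0 // invr_ge0.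
pose a (k : nat) : \bar R :=
  ((boundary_count G0 k)%:R * (k%:R : R) ^ (2%:Z - m.+2%:Z))%:E.
have powE (k : nat) : (k%:R : R) ^ (2%:Z - m.+2%:Z) = k%:R^-1 ^+ m.
  have -> : 2%:Z - m.+2%:Z = - m%:Z by lia.
  by rewrite -exprnN exprVn.
have a0 k : (0 <= a k)%E by rewrite lee_fin powE mulr_ge0 // exprn_ge0 // invr_ge0.
have sumJ k : (\esum_(x in J k) (C * (box_side x)%:R^-1 ^+ m)%:E = C%:E * a k)%E.
  transitivity (\esum_(x in J k) (C * k%:R^-1 ^+ m)%:E)%E.
    by apply: eq_esum => x [_ /(box_boundaryP _ _ (ltn0Sn _)) ->].
  rewrite esum_fset // => [|x _]; last first.
    by rewrite lee_fin mulr_ge0 // exprn_ge0 // invr_ge0.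
  rewrite fsbig_finite //= sumEFin big_const_seq count_predT iter_addr_0.
  by rewrite /a -EFinM powE -[C * _ *+ _]mulr_natl mulrCA.
under eq_eseriesr do rewrite sumJ.
rewrite nneseriesZl // lte_mul_pinfty //.
(* The grouping starts at [k = 0], the hypothesis at [k = 1]; the extra term vanishes, as [0^-1 = 0]
   and [m > 0]. *)
rewrite nneseries_recl // (_ : a 0%N = 0%E) ?add0e //.
by rewrite /a powE invr0 expr0n gtn_eqF // mulr0.
Qed.

(** * Transience *)

Lemma transience_of_hit_prob {R : realType} {V : choiceType} {e : rel V} {o : V}
    {dW : measure_display} {W : measurableType dW} {Q : V -> probability W R}
    {X : nat -> W -> V} {G0 : subgraph e} {c K : R} {r : V -> R}
    {dT : measure_display} {T : measurableType dT} {P : probability T R}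
    {F : nat -> set (set T)} {G : nat -> T -> subgraph e} {Y : nat -> T -> V} :
  locally_finite e -> gconnected setT e -> srw_family e Q X ->
  {ae Q o, forall w, transient_path o (X ^~ w)} ->
  spanning G0 -> missing_edge G0 ->
  (\esum_(x in boundary G0)
     ereal_sup [set Q y [set w | exists n, X n w = o] |
                y in gball e x (r x)] < +oo)%E ->
  growing_walk o G0 F G Y -> extended_srw o G0 P F G Y c r ->
  (forall x n, (\sum_(t < n) P (touch (G := G) (Y := Y) t x) <= K%:E)%E) ->
  {ae P, forall w, transient_path o (Y ^~ w)}.
Proof.
move=> lf conn srw trans sp [a [b [eab _]]] sfin gw es touchK.
(* The missing edge is an edge of the full graph, so no vertex has degree 0. *)
have he : exists x y, e x y by exists a, b.
pose h : V -> R := hit_prob (Q := Q) (X := X) (o := o).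
have lt1 := return_prob_lt1 lf conn he srw trans.
(* Here [gamma] is the probability of never returning to [o], and superharmonicity holds with
   equality. *)
apply: (transience_of_touch_bound lf (countable_vertices lf conn) sp gw es
  (h := h) (gamma := 1 - \sum_(z <- nbrs e o) srw_step e R o z * h z)
  _ _ _ _ K sfin).
- by move=> x; exact: (hit_prob_ge0 srw).
- by rewrite subr_gt0.
- move=> x; have [->|xo] := eqVneq x o; last first.
    by rewrite addr0 {2}/h (hit_prob_harmonic lf conn he srw).
  by rewrite addrC subrK /h (hit_prob_origin lf conn he srw).
- move=> x y _ bxy; rewrite /h (hit_probE srw).
  by apply: ereal_sup_ubound; exists y.
- by move=> x n _; exact: touchK.
Qed.

(** Here [h] is the explicit [potential] and [gamma] its drop at the origin. The dimension is
    [m.+2], so that the exponent [2 - d] is [- m]. *)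
Lemma lattice_transience {R : realType} {m : nat} {G0 : subgraph (@zadj m.+2)}
    {c K : R} {r : 'rV[int]_m.+2 -> R}
    {dT : measure_display} {T : measurableType dT} {P : probability T R}
    {F : nat -> set (set T)} {G : nat -> T -> subgraph (@zadj m.+2)}
    {Y : nat -> T -> 'rV[int]_m.+2} : (0 < m)%N ->
  spanning G0 ->
  (\sum_(1 <= k <oo)
     ((boundary_count G0 k)%:R * (k%:R : R) ^ (2%:Z - m.+2%:Z))%:E < +oo)%E ->
  growing_walk 0 G0 F G Y -> extended_srw 0 G0 P F G Y c r ->
  (forall x n, (\sum_(t < n) P (touch (G := G) (Y := Y) t x) <= K%:E)%E) ->
  {ae P, forall w, transient_path 0 (Y ^~ w)}.
Proof.
move=> m0 sp sfin gw es touchK; have lf := @zadj_locally_finite m.+2.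
have cV := countable_vertices lf zadj_connected.
have [A A0 super] := potential_superharmonic (R := R) m m0.
have c1 := es_c es.
have C0 : 0 <= ((1 - c) / (2 * m.+2%:R))^-1 ^+ m.
  by rewrite exprn_ge0 // invr_ge0 divr_ge0 ?mulr_ge0 // subr_ge0 ltW.
apply: (transience_of_touch_bound lf cV sp gw es (h := potential A m)
  (gamma := potential A m 0 -
    \sum_(z <- nbrs (@zadj m.+2) 0) srw_step (@zadj m.+2) R 0 z * potential A m z)
  _ _ _ _ K (boundary_esum_lt_pinfty G0 _ m0 C0 sfin)).
- by move=> x; exact: potential_ge0.
- by rewrite subr_gt0.
- move=> x; have [->|x0] := eqVneq x 0; first by rewrite addrC subrK.
  by rewrite addr0 ltW.
- move=> x y bx bxy; have [_ rx] := es_radius es bx.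
  rewrite lee_fin; apply: potential_jump_le => //; last exact: le_trans bxy rx.
  (* A boundary vertex is not the origin, whose star is open. *)
  have v0 : vert G0 0 by rewrite (sp : vert G0 = setT).
  apply/eqP => x0; move: bx; rewrite x0 => /(boundaryE lf v0); apply.
  exact: gw_star gw.
- by move=> x n _; exact: touchK.
Qed.

Theorem proposition1p7 (R : realType) :
  (forall (V : choiceType) (e : rel V) (o : V),
    symmetric e -> irreflexive e -> locally_finite e -> gconnected setT e ->
    forall (dW : measure_display) (W : measurableType dW)
           (Q : V -> probability W R) (X : nat -> W -> V),
    srw_family e Q X ->
    {ae Q o, forall w, transient_path o (X ^~ w)} ->
    forall G0 : subgraph e, spanning G0 -> missing_edge G0 ->
    forall (c : R) (r : V -> R),
    (\esum_(x in boundary G0)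
       ereal_sup [set Q y [set w | exists n, X n w = o] |
                  y in gball e x (r x)] < +oo)%E ->
    (forall (dT : measure_display) (T : measurableType dT)
            (P : probability T R) (F : nat -> set (set T))
            (G : nat -> T -> subgraph e) (Y : nat -> T -> V),
       growing_walk o G0 F G Y -> OBT G Y -> extended_srw o G0 P F G Y c r ->
       {ae P, forall w, transient_path o (Y ^~ w)})
    /\
    (bounded_degrees e ->
     forall (dT : measure_display) (T : measurableType dT)
            (P : probability T R) (F : nat -> set (set T))
            (G : nat -> T -> subgraph e) (Y : nat -> T -> V),
       growing_walk o G0 F G Y -> POBT P G Y ->
       extended_srw o G0 P F G Y c r ->
       {ae P, forall w, transient_path o (Y ^~ w)}))
  /\
  (forall d : nat, (3 <= d)%N ->
    forall G0 : subgraph (@zadj d), spanning G0 -> missing_edge G0 ->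
    (\sum_(1 <= k <oo)
       ((boundary_count G0 k)%:R * (k%:R : R) ^ (2%:Z - d%:Z))%:E < +oo)%E ->
    forall (c : R) (r : 'rV[int]_d -> R)
           (dT : measure_display) (T : measurableType dT)
           (P : probability T R) (F : nat -> set (set T))
           (G : nat -> T -> subgraph (@zadj d)) (Y : nat -> T -> 'rV[int]_d),
      growing_walk 0 G0 F G Y -> POBT P G Y ->
      extended_srw 0 G0 P F G Y c r ->
      {ae P, forall w, transient_path 0 (Y ^~ w)}).
Proof.
(* Dimensions 0 and 1 contradict [3 <= d]; for [d = m.+2] it reads [0 < m]. *)
split=> [V e o _ _ lf conn dW W Q X srw trans G0 sp me c r sfin|
    [//|[//|m]] m0 G0 sp _ sfin c r dT T P F G Y gw pobt es].
  have main := transience_of_hit_prob lf conn srw trans sp me sfin.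
  split=> [dT T P F G Y gw obt es|bdeg dT T P F G Y gw pobt es].
    exact: main gw es (OBT_touch_bound lf sp gw obt).
  have cV := countable_vertices lf conn.
  have [K touchK] := POBT_touch_bound lf sp gw cV bdeg pobt.
  exact: main gw es touchK.
have lf := @zadj_locally_finite m.+2.
have cV := countable_vertices lf zadj_connected.
have bdeg : bounded_degrees (@zadj m.+2).
  by exists (m.+2 * 2)%N => x; rewrite zadj_degree.
have [K touchK] := POBT_touch_bound lf sp gw cV bdeg pobt.
exact: (lattice_transience m0 sp sfin gw es touchK).
Qed.
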